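(* Let $G$ be a finite group. Call a lazy $2$-cocycle $\sigma\in\mathrm{Z}^2_L(DG^* )$ symmetric if for all $g,t,h,s\in G$ $$\sigma(g\times e_t,\ h^g\times e_s)=\sigma(h\times e_{gs(g^{-1})^t},\ g\times e_t).$$ Then every symmetric lazy $2$-cocycle on $DG^*$ is cohomologically equivalent in $\mathrm{H}^2(DG^* )$ to a lazy $2$-cocycle in the image of the map $\mathrm{Z}^2_{inv}(G,k^\times)\to\mathrm{Z}^2_L(DG^* )$, $\beta\mapsto\sigma_\beta$, where $\sigma_\beta(g\times e_x,h\times e_y)=\beta(g,h)\epsilon(e_x)\epsilon(e_y)$.
   Context: $k$ is an algebraically closed field of characteristic zero, $G$ a finite group, $k^G$ the function algebra with basis $e_x$, $e_x(y)=\delta_{x,y}$, $\epsilon(e_x)=\delta_{x,1}$. Conjugation notation: $g^t=t^{-1}gt$. Sweedler notation $\Delta(a)=a_1\otimes a_2$ is used. $DG^*$, the dual of the Drinfeld double, is the Hopf algebra with basis $x\times e_y$ ($x,y\in G$), product $(x\times e_y)(x'\times e_{y'})=xx'\times e_ye_{y'}$ (pointwise product in $k^G$), coproduct $\Delta(x\times e_y)=\sum_{y_1y_2=y}(x\times e_{y_1})\otimes(y_1^{-1}xy_1\times e_{y_2})$, counit $\epsilon(x\times e_y)=\delta_{y,1}$. For a Hopf algebra $H$: $\mathrm{Reg}^1(H)$ is the group of convolution invertible linear $\eta:H\to k$ with $\eta(1)=1$; $\mathrm{Z}^2(H)$ is the set of convolution invertible $\sigma:H\otimes H\to k$ with $\sigma(1,h)=\epsilon(h)=\sigma(h,1)$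 and $\sigma(a_1,b_1)\sigma(a_2b_2,c)=\sigma(b_1,c_1)\sigma(a,b_2c_2)$. Two $2$-cocycles $\sigma,\tau$ are cohomologically equivalent in $\mathrm{H}^2(H)$ if there is $\eta\in\mathrm{Reg}^1(H)$ with $\sigma(a,b)=\eta(a_1)\eta(b_1)\tau(a_2,b_2)\eta^{-1}(a_3b_3)$ for all $a,b$. A $2$-cocycle is lazy if $\sigma(a_1,b_1)a_2b_2=a_1b_1\sigma(a_2,b_2)$ for all $a,b$; $\mathrm{Z}^2_L(H)$ is the group of lazy $2$-cocycles. $\mathrm{Z}^2_{inv}(G,k^\times)$ is the group of (normalized) $2$-cocycles $\beta\in\mathrm{Z}^2(G,k^\times)$ with $\beta(g,h)=\beta(g^t,h^t)$ for all $g,h,t\in G$. *)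

(* Defs.v *)
From HB Require Import structures.
From mathcomp Require Import all_boot all_order all_algebra all_fingroup.

Set Implicit Arguments.
Unset Strict Implicit.
Unset Printing Implicit Defensive.

Import GRing.Theory.

Local Open Scope ring_scope.

Reserved Notation "\sw_ ( a1 , a2 <- a ) F"
  (at level 41, a1 binder, a2 binder, F at level 41,
   format "\sw_ ( a1 ,  a2  <-  a )  F").
Reserved Notation "\sw_ ( a1 , a2 , a3 <- a ) F"
  (at level 41, a1 binder, a2 binder, a3 binder, F at level 41,
   format "\sw_ ( a1 ,  a2 ,  a3  <-  a )  F").

(* The dual DG^* of the Drinfeld double. An element is its family of
   coordinates in the basis x \times e_y, which is indexed by the pairs (x, y).
   Only the module structure is that of {ffun gT * gT -> k^o}. *)
Definition dualdouble (k : fieldType) (gT : finGroupType) : Type :=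
  {ffun gT * gT -> k^o}.

HB.instance Definition _ k gT :=
  GRing.Lmodule.copy (dualdouble k gT) {ffun gT * gT -> k^o}.

Section DualDouble.

Variables (k : fieldType) (gT : finGroupType).

Local Notation H := (dualdouble k gT).
Implicit Types (x y : gT) (a b c : H).

Definition dd_coord a (p : gT * gT) : k := (a : {ffun gT * gT -> k^o}) p.

(* x \times e_y *)
Definition dd_elt x y : H :=
  [ffun p : gT * gT => ((p == (x, y))%:R : k^o)].

Lemma dd_coordP a b : dd_coord a =1 dd_coord b -> a = b.
Proof. by move=> eqab; apply/ffunP. Qed.

Lemma dd_coordD a b p : dd_coord (a + b) p = dd_coord a p + dd_coord b p.
Proof. exact: ffunE. Qed.

Lemma dd_coordZ r a p : dd_coord (r *: a) p = r * dd_coord a p.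
Proof. exact: ffunE. Qed.

Lemma dd_coord_elt x y p : dd_coord (dd_elt x y) p = (p == (x, y))%:R.
Proof. exact: ffunE. Qed.

Lemma dd_coord0 p : dd_coord 0 p = 0.
Proof. exact: ffunE. Qed.

Lemma dd_coord_sum (I : Type) (r : seq I) (P : pred I) (F : I -> H) p :
  dd_coord (\sum_(i <- r | P i) F i) p = \sum_(i <- r | P i) dd_coord (F i) p.
Proof.
by apply: (big_morph (dd_coord^~ p) (fun a b => dd_coordD a b p) (dd_coord0 p)).
Qed.

Lemma dd_decomp a : a = \sum_p dd_coord a p *: dd_elt p.1 p.2.
Proof.
apply: dd_coordP => q; rewrite dd_coord_sum (bigD1 q) //= big1 ?addr0.
  by rewrite dd_coordZ dd_coord_elt -surjective_pairing eqxx mulr1.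
move=> p neq_pq; rewrite dd_coordZ dd_coord_elt -surjective_pairing.
by rewrite eq_sym (negbTE neq_pq) mulr0.
Qed.

(* Convolution in the group algebra coordinate, pointwise in the k^G one; see
   dd_mul_elt for the values on the basis. *)
Definition dd_mul a b : H :=
  [ffun p : gT * gT =>
     (\sum_x dd_coord a (x, p.2) * dd_coord b (x^-1 * p.1, p.2)%g : k^o)].

(* 1_G \times 1_{k^G} *)
Definition dd_one : H := [ffun p : gT * gT => ((p.1 == 1%g)%:R : k^o)].

Lemma dd_coord_mul a b p :
  dd_coord (dd_mul a b) p =
    \sum_x dd_coord a (x, p.2) * dd_coord b (x^-1 * p.1, p.2)%g.
Proof. exact: ffunE. Qed.

Lemma dd_coord_one p : dd_coord dd_one p = (p.1 == 1%g)%:R.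
Proof. exact: ffunE. Qed.

Fact dd_mulA : associative dd_mul.
Proof.
move=> a b c; apply: dd_coordP => p; rewrite !dd_coord_mul.
under eq_bigr do rewrite dd_coord_mul mulr_sumr.
under [RHS]eq_bigr do rewrite dd_coord_mul mulr_suml.
rewrite [RHS]exchange_big /=; apply: eq_bigr => x _ /=.
rewrite [RHS](reindex_inj (mulgI x)) /=; apply: eq_bigr => y _.
by rewrite mulrA mulKg invMg mulgA.
Qed.

Fact dd_mul1 : left_id dd_one dd_mul.
Proof.
move=> a; apply: dd_coordP => p; rewrite dd_coord_mul (bigD1 1%g) //= big1.
  by rewrite dd_coord_one eqxx mul1r addr0 invg1 mul1g -surjective_pairing.
by move=> x /negbTE nx1; rewrite dd_coord_one /= nx1 mul0r.
Qed.

Fact dd_mulr1 : right_id dd_one dd_mul.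
Proof.
move=> a; apply: dd_coordP => p; rewrite dd_coord_mul (bigD1 p.1) //= big1.
  by rewrite dd_coord_one /= mulVg eqxx mulr1 addr0 -surjective_pairing.
move=> x /negbTE nx1; rewrite dd_coord_one /= -(inj_eq (mulgI x)) mulKVg mulg1.
by rewrite eq_sym nx1 mulr0.
Qed.

Fact dd_mulDl : left_distributive dd_mul +%R.
Proof.
move=> a b c; apply: dd_coordP => p; rewrite dd_coordD !dd_coord_mul -big_split.
by apply: eq_bigr => x _ /=; rewrite dd_coordD mulrDl.
Qed.

Fact dd_mulDr : right_distributive dd_mul +%R.
Proof.
move=> a b c; apply: dd_coordP => p; rewrite dd_coordD !dd_coord_mul -big_split.
by apply: eq_bigr => x _ /=; rewrite dd_coordD mulrDr.
Qed.

Fact dd_one_neq0 : dd_one != 0 :> H.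
Proof.
apply/eqP => /(congr1 (dd_coord^~ (1%g, 1%g))) /eqP.
by rewrite dd_coord_one dd_coord0 eqxx oner_eq0.
Qed.

HB.instance Definition _ := GRing.Zmodule_isNzRing.Build (dualdouble k gT)
  dd_mulA dd_mul1 dd_mulr1 dd_mulDl dd_mulDr dd_one_neq0.

Fact dd_scaleAl r a b : r *: (a * b) = (r *: a) * b.
Proof.
apply: dd_coordP => p; rewrite dd_coordZ !dd_coord_mul mulr_sumr.
by apply: eq_bigr => x _; rewrite dd_coordZ mulrA.
Qed.

HB.instance Definition _ :=
  GRing.Lmodule_isLalgebra.Build k (dualdouble k gT) dd_scaleAl.

Fact dd_scaleAr r a b : r *: (a * b) = a * (r *: b).
Proof.
apply: dd_coordP => p; rewrite dd_coordZ !dd_coord_mul mulr_sumr.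
by apply: eq_bigr => x _; rewrite dd_coordZ mulrCA.
Qed.

HB.instance Definition _ :=
  GRing.Lalgebra_isAlgebra.Build k (dualdouble k gT) dd_scaleAr.

Lemma dd_mul_elt x y x' y' :
  dd_elt x y * dd_elt x' y' = (y == y')%:R *: dd_elt (x * x')%g y.
Proof.
apply: dd_coordP => -[u v]; rewrite dd_coordZ dd_coord_mul (bigD1 x) //= big1.
  rewrite addr0 !dd_coord_elt !xpair_eqE eqxx /= -(inj_eq (mulgI x) (x^-1 * u)%g) mulKVg.
  case: (v =P y) => [->|_]; last by rewrite andbF !mul0r mulr0.
  by rewrite andbT mul1r mulrC -natrM mulnb andbC.
by move=> z /negbTE nzx; rewrite dd_coord_elt xpair_eqE nzx mul0r.
Qed.

Lemma dd_oneE : 1 = \sum_y dd_elt 1%g y :> H.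
Proof.
apply: dd_coordP => -[u v]; rewrite dd_coord_sum dd_coord_one (bigD1 v) //=.
rewrite big1 => [|y /negbTE nyv]; first by rewrite dd_coord_elt xpair_eqE eqxx andbT addr0.
by rewrite dd_coord_elt xpair_eqE [v == y]eq_sym nyv andbF.
Qed.

Definition dd_counit a : k := \sum_x dd_coord a (x, 1%g).

Fact dd_counit_is_linear : scalar dd_counit.
Proof.
move=> r a b; rewrite /dd_counit mulr_sumr -big_split.
by apply: eq_bigr => x _; rewrite dd_coordD dd_coordZ.
Qed.

HB.instance Definition _ :=
  GRing.isLinear.Build k (dualdouble k gT) k *%R dd_counit dd_counit_is_linear.

Lemma dd_counit_elt x y : dd_counit (dd_elt x y) = (y == 1%g)%:R.
Proof.
rewrite /dd_counit (bigD1 x) //= big1 => [|z /negbTE nzx].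
  by rewrite dd_coord_elt xpair_eqE eqxx addr0 eq_sym.
by rewrite dd_coord_elt xpair_eqE nzx.
Qed.

(* The coproduct, with values in the coordinates of the tensor square of
   DG^* in the basis (x \times e_y1) \otimes (x' \times e_y2). *)
Definition dd_comul a : {ffun (gT * gT) * (gT * gT) -> k^o} :=
  [ffun q : (gT * gT) * (gT * gT) =>
    (if q.2.1 == (q.1.1 ^ q.1.2)%g
     then dd_coord a (q.1.1, q.1.2 * q.2.2)%g else 0 : k^o)].

(* Sweedler's notation: the value at Delta(a) of the linear map on the tensor
   square induced by f. It is meaningful only for bilinear f. *)
Definition sweedler (V : lmodType k) (f : H -> H -> V) a : V :=
  \sum_q dd_comul a q *: f (dd_elt q.1.1 q.1.2) (dd_elt q.2.1 q.2.2).

End DualDouble.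

Notation "\sw_ ( a1 , a2 <- a ) F" := (sweedler (fun a1 a2 => F) a) : ring_scope.
Notation "\sw_ ( a1 , a2 , a3 <- a ) F" :=
  (sweedler (fun a1 a' => sweedler (fun a2 a3 => F) a') a) : ring_scope.

Section Cohomology.

Variables (k : fieldType) (gT : finGroupType).

Local Notation H := (dualdouble k gT).
Implicit Types (a b c : H) (eta : {scalar H}) (sigma tau : {biscalar H}).

Lemma sweedler_elt (V : lmodType k) (f : H -> H -> V) (x y : gT) :
  \sw_(a1, a2 <- dd_elt k x y) f a1 a2 =
    \sum_y1 f (dd_elt k x y1) (dd_elt k (x ^ y1)%g (y1^-1 * y)%g).
Proof.
pose h y1 : (gT * gT) * (gT * gT) := ((x, y1), ((x ^ y1)%g, (y1^-1 * y)%g)).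
have h_inj : injective h by move=> y1 y2 [].
rewrite /sweedler (bigID (mem (codom h))) /= addrC big1 => [|q q_nh]; last first.
  rewrite ffunE; case: eqP => [q21|_]; last by rewrite scale0r.
  rewrite dd_coord_elt; case: eqP => [[qx qy]|_]; last by rewrite scale0r.
  case/negP: q_nh; apply/codomP; exists q.1.2.
  rewrite /h -qx -qy mulKg -q21; case: q {q21 qx qy} => [[? ?] [? ?]] //.
rewrite add0r -big_uniq /=; last by rewrite map_inj_uniq ?enum_uniq.
rewrite big_map big_enum; apply: eq_bigr => y1 _ /=.
by rewrite ffunE /= eqxx dd_coord_elt mulKVg eqxx scale1r.
Qed.

Lemma sweedlerA (V : lmodType k) (f : H -> H -> H -> V) a :
  \sw_(a', a3 <- a) \sw_(a1, a2 <- a') f a1 a2 a3 =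
  \sw_(a1, a2, a3 <- a) f a1 a2 a3.
Proof.
have sw_lin (W : lmodType k) (g : H -> H -> W) : linear (sweedler g).
  move=> r u v; rewrite /sweedler scaler_sumr -big_split /=.
  apply: eq_bigr => q _; rewrite !ffunE dd_coordD dd_coordZ.
  case: ifP => _; first by rewrite scalerDl scalerA.
  by rewrite !scale0r scaler0 addr0.
pose L (W : lmodType k) (g : H -> H -> W) : {linear H -> W} :=
  HB.pack (sweedler g) (GRing.isLinear.Build k H W _ _ (sw_lin W g)).
rewrite [a]dd_decomp -![sweedler _ (\sum_p _)]/(L _ _ _) !linear_sum.
apply: eq_bigr => -[x y] _; rewrite !linearZ /=; congr (_ *: _).
rewrite !sweedler_elt.
under eq_bigr do rewrite sweedler_elt.
under [RHS]eq_bigr do rewrite sweedler_elt.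
rewrite exchange_big; apply: eq_bigr => y1 _ /=.
rewrite (reindex_inj (mulgI y1)); apply: eq_bigr => y2 _ /=.
by rewrite mulKg conjgM invMg mulgA.
Qed.

Definition conv1 eta eta' a : k :=
  \sw_(a1, a2 <- a) (eta a1 * eta' a2 : k^o).

Definition conv_inverse1 eta eta' : Prop :=
  forall a, conv1 eta eta' a = dd_counit a /\ conv1 eta' eta a = dd_counit a.

Definition Reg1 eta : Prop :=
  (exists eta', conv_inverse1 eta eta') /\ eta 1 = 1.

Definition conv2 sigma tau a b : k :=
  \sw_(a1, a2 <- a) \sw_(b1, b2 <- b) (sigma a1 b1 * tau a2 b2 : k^o).

Definition conv_inverse2 sigma tau : Prop :=
  forall a b, conv2 sigma tau a b = dd_counit a * dd_counit b /\
              conv2 tau sigma a b = dd_counit a * dd_counit b.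

Definition Z2 sigma : Prop :=
  [/\ exists tau, conv_inverse2 sigma tau,
      forall a, sigma 1 a = dd_counit a /\ sigma a 1 = dd_counit a
    & forall a b c,
        \sw_(a1, a2 <- a) \sw_(b1, b2 <- b)
          (sigma a1 b1 * sigma (a2 * b2) c : k^o) =
        \sw_(b1, b2 <- b) \sw_(c1, c2 <- c)
          (sigma b1 c1 * sigma a (b2 * c2) : k^o)].

Definition lazy_cocycle sigma : Prop :=
  forall a b,
    \sw_(a1, a2 <- a) \sw_(b1, b2 <- b) (sigma a1 b1 *: (a2 * b2)) =
    \sw_(a1, a2 <- a) \sw_(b1, b2 <- b) (sigma a2 b2 *: (a1 * b1)).

Definition Z2L sigma : Prop := Z2 sigma /\ lazy_cocycle sigma.

Definition cohomologous sigma tau : Prop :=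
  exists eta eta', [/\ Reg1 eta, conv_inverse1 eta eta' &
    forall a b, sigma a b =
      \sw_(a1, a2, a3 <- a) \sw_(b1, b2, b3 <- b)
        (eta a1 * eta b1 * tau a2 b2 * eta' (a3 * b3) : k^o)].

Definition symmetric_cocycle sigma : Prop :=
  forall g t h s : gT,
    sigma (dd_elt k g t) (dd_elt k (h ^ g)%g s) =
    sigma (dd_elt k h (g * s * (g^-1) ^ t)%g) (dd_elt k g t).

(* k^x is encoded by the nonzero values in k. *)
Definition Z2inv (beta : gT -> gT -> k) : Prop :=
  [/\ forall g h, beta g h != 0,
      forall g, beta 1%g g = 1 /\ beta g 1%g = 1,
      forall g h f,
        beta g h * beta (g * h)%g f = beta h f * beta g (h * f)%g
    & forall g h t, beta g h = beta (g ^ t)%g (h ^ t)%g].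

(* The bilinear extension of
   (g \times e_x, h \times e_y) |-> beta(g, h) epsilon(e_x) epsilon(e_y); see
   sigma_of_elt. *)
Definition sigma_of (beta : gT -> gT -> k) a b : k :=
  \sum_p \sum_q dd_coord a p * dd_coord b q *
    (beta p.1 q.1 * (p.2 == 1%g)%:R * (q.2 == 1%g)%:R).

Fact sigma_of_is_bilinear beta :
  bilinear_for
    (GRing.Scale.Law.clone _ _ *%R _) (GRing.Scale.Law.clone _ _ *%R _)
    (sigma_of beta : H -> H -> k).
Proof.
split=> [b|a] r u v; rewrite /sigma_of /= mulr_sumr -big_split /=.
  apply: eq_bigr => p _; rewrite mulr_sumr -big_split /=.
  by apply: eq_bigr => q _; rewrite dd_coordD dd_coordZ !mulrDl !mulrA.
apply: eq_bigr => p _; rewrite mulr_sumr -big_split /=.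
apply: eq_bigr => q _; rewrite dd_coordD dd_coordZ mulrDr mulrDl.
by rewrite [_ * (r * _)]mulrCA !mulrA.
Qed.

HB.instance Definition _ beta :=
  bilinear_isBilinear.Build k (dualdouble k gT) (dualdouble k gT) k *%R *%R
    (sigma_of beta) (sigma_of_is_bilinear beta).

Lemma sigma_of_elt beta (g x h y : gT) :
  sigma_of beta (dd_elt k g x) (dd_elt k h y) =
    beta g h * (x == 1%g)%:R * (y == 1%g)%:R.
Proof.
rewrite /sigma_of (bigD1 (g, x)) //= [X in _ + X]big1 => [|p /negbTE np]; last first.
  by apply: big1 => q _; rewrite !dd_coord_elt np !mul0r.
rewrite (bigD1 (h, y)) //= [X in _ + X + _]big1 => [|q /negbTE nq]; last first.
  by rewrite !dd_coord_elt nq mulr0 mul0r.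
by rewrite !dd_coord_elt !eqxx !mul1r !addr0.
Qed.

End Cohomology.

(* Main.v *)
(* Dually, sigma is a twist F in D \otimes D for the Drinfeld double D = D(G),
   invariant under the conjugations and satisfying R F = F_21 R, and cohomologous
   twists are the (w \otimes w)^-1 F Delta(w) with w invertible in D.
   The image of F in kG \otimes kG, under the projection D -> kG, is a symmetric
   twist; it makes the function algebra of G a commutative algebra, whose
   characters u in kG trivialize it. Modify F by u. The image X of F in
   D \otimes kG then satisfies a cocycle condition, with solutions of
   X (id \otimes pi) Delta(v) = v \otimes 1 given explicitly by the coefficients
   of X; the invariance of F provides an invertible one, and modifying F by v
   makes X trivial. The R-matrix exchanges the two factors, so the image of F in
   kG \otimes D becomes trivial as well, and then the cocycle condition forces F
   to be a function b(g, h) in k^G \otimes k^G, i.e., F is the twist of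
   sigma_b for a 2-cocycle b.
   There remains to make b invariant. The element w = u v satisfies
   w e_g = e_phi(g) w, where phi is the automorphism g |-> u g u^-1 of G, and
   phi(y)^-1 w y = w d_y for functions d_y. Comparing traces on commuting pairs
   gives d_y(h) = 1 when y centralises h, which is the only obstruction to
   rescaling w by a function so that w y = phi(y) w for all y in G; the
   corresponding b is invariant because F is. *)

Require Import Defs.
From HB Require Import structures.
From mathcomp Require Import all_boot all_order all_algebra all_fingroup.

Set Implicit Arguments.
Unset Strict Implicit.
Unset Printing Implicit Defensive.

Import GRing.Theory.
Local Open Scope ring_scope.

(* The Drinfeld double of gT, i.e., the algebra of functions on gT crossed with
   gT acting by conjugation: a is the sum of the a (x, y) e_x y. *)
Definition drinfeld (k : fieldType) (gT : finGroupType) : Type :=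
  {ffun gT * gT -> k^o}.

HB.instance Definition _ k gT :=
  GRing.Lmodule.copy (drinfeld k gT) {ffun gT * gT -> k^o}.
HB.instance Definition _ k gT :=
  Vector.copy (drinfeld k gT) {ffun gT * gT -> k^o}.

(** * The Drinfeld double as an algebra *)

Section Drinfeld.

Variables (k : fieldType) (gT : finGroupType).
Local Notation D := (drinfeld k gT).
Implicit Types (a b c : D) (x y z t : gT).

Definition cf a x y : k := (a : {ffun gT * gT -> k^o}) (x, y).
Definition mkD (f : gT -> gT -> k) : D := [ffun p => f p.1 p.2 : k^o].

Lemma cfE f x y : cf (mkD f) x y = f x y.
Proof. exact: ffunE. Qed.

Lemma cfP a b : (forall x y, cf a x y = cf b x y) -> a = b.
Proof. by move=> eq_ab; apply/ffunP => -[x y]; apply: eq_ab. Qed.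

Lemma cfD a b x y : cf (a + b) x y = cf a x y + cf b x y.
Proof. exact: ffunE. Qed.

Lemma cf0 x y : cf 0 x y = 0.
Proof. exact: ffunE. Qed.

(** This is the rule (e_x z)(e_x' y) = delta_(x', x^z) e_x zy, dual to the coproduct of DG^* on its
    basis. *)
Definition dmul a b : D :=
  mkD (fun x y => \sum_z cf a x z * cf b (x ^ z)%g (z^-1 * y)%g).
Definition dunit : D := mkD (fun x y => (y == 1%g)%:R).

Fact dmulA : associative dmul.
Proof.
move=> a b c; apply: cfP => x y; rewrite !cfE.
under eq_bigr do rewrite cfE mulr_sumr.
under [RHS]eq_bigr do rewrite cfE mulr_suml.
rewrite [RHS]exchange_big /=; apply: eq_bigr => z _ /=.
rewrite [RHS](reindex_inj (mulgI z)) /=; apply: eq_bigr => t _.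
by rewrite mulrA mulKg invMg mulgA conjgM.
Qed.

Fact dmul1 : left_id dunit dmul.
Proof.
move=> a; apply: cfP => x y; rewrite cfE (bigD1 1%g) //= big1.
  by rewrite cfE eqxx mul1r addr0 invg1 mul1g conjg1.
by move=> z /negbTE nz1; rewrite cfE nz1 mul0r.
Qed.

Fact dmulr1 : right_id dunit dmul.
Proof.
move=> a; apply: cfP => x y; rewrite cfE (bigD1 y) //= big1.
  by rewrite cfE mulVg eqxx mulr1 addr0.
move=> z /negbTE nzy; rewrite cfE -(inj_eq (mulgI z)) mulKVg mulg1.
by rewrite eq_sym nzy mulr0.
Qed.

Fact dmulDl : left_distributive dmul +%R.
Proof.
move=> a b c; apply: cfP => x y; rewrite cfD !cfE -big_split.
by apply: eq_bigr => z _ /=; rewrite cfD mulrDl.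
Qed.

Fact dmulDr : right_distributive dmul +%R.
Proof.
move=> a b c; apply: cfP => x y; rewrite cfD !cfE -big_split.
by apply: eq_bigr => z _ /=; rewrite cfD mulrDr.
Qed.

Fact dunit_neq0 : dunit != 0 :> D.
Proof.
by apply/eqP => /(congr1 (fun a => cf a 1%g 1%g))/eqP; rewrite cfE cf0 eqxx oner_eq0.
Qed.

HB.instance Definition _ := GRing.Zmodule_isNzRing.Build (drinfeld k gT)
  dmulA dmul1 dmulr1 dmulDl dmulDr dunit_neq0.

Lemma cfM a b x y :
  cf (a * b) x y = \sum_z cf a x z * cf b (x ^ z)%g (z^-1 * y)%g.
Proof. exact: cfE. Qed.

Lemma cf1 x y : cf 1 x y = (y == 1%g)%:R.
Proof. exact: cfE. Qed.

Definition idem x : D := mkD (fun x' y => ((x' == x) && (y == 1%g))%:R).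
Definition grp y : D := mkD (fun x y' => (y' == y)%:R).
Definition dfun (f : gT -> k) : D := mkD (fun x y => f x * (y == 1%g)%:R).

Lemma cf_dfunl f a x y : cf (dfun f * a) x y = f x * cf a x y.
Proof.
rewrite cfM (bigD1 1%g) //= big1 ?addr0.
  by rewrite cfE eqxx mulr1 conjg1 invg1 mul1g.
by move=> z /negbTE nz1; rewrite cfE nz1 mulr0 mul0r.
Qed.

Lemma cf_dfunr f a x y : cf (a * dfun f) x y = cf a x y * f (x ^ y)%g.
Proof.
rewrite cfM (bigD1 y) //= big1 ?addr0; first by rewrite cfE mulVg eqxx mulr1.
move=> z /negbTE nzy; rewrite cfE -(inj_eq (mulgI z)) mulKVg mulg1.
by rewrite eq_sym nzy !mulr0.
Qed.

Lemma cf_grpl z a x y : cf (grp z * a) x y = cf a (x ^ z)%g (z^-1 * y)%g.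
Proof.
rewrite cfM (bigD1 z) //= big1 ?addr0; first by rewrite cfE eqxx mul1r.
by move=> t /negbTE ntz; rewrite cfE ntz mul0r.
Qed.

Lemma cf_grpr z a x y : cf (a * grp z) x y = cf a x (y * z^-1)%g.
Proof.
rewrite cfM (bigD1 (y * z^-1)%g) //= big1 ?addr0.
  by rewrite cfE invMg invgK mulgKV eqxx mulr1.
move=> t ntyz; rewrite cfE; case: eqP => [def_z|_]; last by rewrite mulr0.
by case/eqP: ntyz; rewrite -def_z invMg invgK mulKVg.
Qed.

Lemma idemE x : idem x = dfun (fun x' => (x' == x)%:R).
Proof. by apply: cfP => x' y; rewrite !cfE -natrM mulnb. Qed.

Lemma dfunM f g : dfun f * dfun g = dfun (fun x => f x * g x).
Proof. by apply: cfP => x y; rewrite cf_dfunl !cfE mulrA. Qed.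

Lemma grpM y z : grp y * grp z = grp (y * z)%g.
Proof.
by apply: cfP => x t; rewrite cf_grpl !cfE -(inj_eq (mulgI y)) mulKVg.
Qed.

Lemma grp1 : grp 1%g = 1.
Proof. by apply: cfP => x t; rewrite cfE. Qed.

Lemma grpV y : grp y * grp y^-1%g = 1 /\ grp y^-1%g * grp y = 1.
Proof. by rewrite !grpM mulgV mulVg grp1. Qed.

(** By finite dimension an injective left multiplication is onto, so a b = 1 for some b; then a (b a
    - 1) = 0 makes b a two-sided inverse. *)
Lemma drinfeld_unit a :
  (forall b, a * b = 0 -> b = 0) -> exists b, a * b = 1 /\ b * a = 1.
Proof.
move=> a_reg.
have lin_mul : linear (fun b : D => a * b).
  move=> r b c; apply: cfP => x y; rewrite cfD !cfM.
  have cfZ (d : D) u v : cf (r *: d) u v = r * cf d u v by exact: ffunE.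
  rewrite cfZ cfM mulr_sumr -big_split; apply: eq_bigr => z _ /=.
  by rewrite cfD cfZ mulrDr mulrCA.
pose L : {linear D -> D} :=
  HB.pack (fun b => a * b) (GRing.isLinear.Build k D D _ _ lin_mul).
have kerL : lker (linfun L) == 0%VS.
  apply/eqP/vspaceP => b; rewrite memv_ker memv0 lfunE /=.
  by apply/eqP/eqP => [/a_reg|->]; rewrite ?mulr0.
have limgL : limg (linfun L) = fullv.
  by apply/eqP; rewrite eqEdim subvf /= limg_dim_eq // (eqP kerL) capv0.
have /memv_imgP[b _ def1] : 1 \in limg (linfun L) by rewrite limgL memvf.
rewrite lfunE /= in def1; exists b; split; first by [].
apply/eqP; rewrite -subr_eq0; apply/eqP/a_reg.
by rewrite mulrBr mulrA -def1 mul1r mulr1 subrr.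
Qed.

End Drinfeld.

(** * Algebra maps between doubles induced by maps of groups *)

Section Pull.

Variables (k : fieldType) (gT hT : finGroupType) (p : hT -> gT) (i : gT -> hT).
Hypothesis iM : {morph i : x y / (x * y)%g}.
Hypothesis pJ : forall x y, p (x ^ i y)%g = (p x ^ y)%g.

(* e_x y |-> (\sum_(p x' = x) e_x') i(y). *)
Definition pull (a : drinfeld k gT) : drinfeld k hT :=
  mkD (fun x y => \sum_(z | i z == y) cf a (p x) z).

(** All the structure maps between tensor powers of D are instances of [pull]: inclusions,
    coproducts and the flip get their multiplicativity from here. *)
Lemma pullM a b : pull (a * b) = pull a * pull b.
Proof.
apply: cfP => x y; rewrite cfM cfE.
under eq_bigr do rewrite cfM.
rewrite exchange_big /= (partition_big i predT) //=; apply: eq_bigr => y1 _.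
rewrite !cfE mulr_suml; apply: eq_bigr => z1 /eqP <-.
rewrite mulr_sumr pJ (reindex_inj (mulgI z1)) /=.
apply: eq_big => [z2|z2 _]; last by rewrite mulKg.
by rewrite iM -(inj_eq (mulgI (i z1)^-1%g)) mulKg.
Qed.

Lemma pull1 : pull 1 = 1.
Proof.
have i1 : i 1%g = 1%g by apply: (mulgI (i 1%g)); rewrite -iM !mulg1.
apply: cfP => x y; rewrite cf1 cfE; rewrite big_mkcond /=.
rewrite (bigD1 1%g) //= big1 ?addr0 => [|z /negbTE nz1]; last first.
  by rewrite cf1 nz1 if_same.
by rewrite cf1 i1 eqxx [y == _]eq_sym; case: eqP.
Qed.

Lemma pull0 : pull 0 = 0.
Proof. by apply: cfP => x y; rewrite cf0 cfE big1 // => z _; apply: cf0. Qed.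

Lemma cf_pull_mul a (c : drinfeld k hT) x y :
  cf (pull a * c) x y =
    \sum_z cf a (p x) z * cf c (x ^ i z)%g ((i z)^-1 * y)%g.
Proof.
rewrite cfM (partition_big i predT) //=; apply: eq_bigr => y1 _.
by rewrite cfE mulr_suml; apply: eq_bigr => z /eqP <-.
Qed.

Lemma cf_mul_pull a (c : drinfeld k hT) x y :
  cf (c * pull a) x y =
    \sum_z cf c x (y * (i z)^-1)%g * cf a (p (x ^ (y * (i z)^-1))%g) z.
Proof.
rewrite cfM (reindex_inj invg_inj) (reindex_inj (mulIg y^-1%g)) /=.
rewrite (partition_big i predT) //=; apply: eq_bigr => y1 _.
rewrite cfE !invMg !invgK mulgKV mulr_sumr.
by apply: eq_bigr => z /eqP <-.
Qed.

Lemma cf_pull j a x y : cancel i j ->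
  cf (pull a) x y = (i (j y) == y)%:R * cf a (p x) (j y).
Proof.
move=> iK; rewrite cfE big_mkcond (bigD1 (j y)) //= big1 ?addr0.
  by case: eqP; rewrite ?mul1r ?mul0r.
by move=> z /negbTE nzj; case: eqP => // def_y; rewrite -def_y iK eqxx in nzj.
Qed.

End Pull.

Lemma pull_comp (k : fieldType) (gT hT lT : finGroupType) (p1 : hT -> gT)
    (i1 : gT -> hT) (p2 : lT -> hT) (i2 : hT -> lT) (p3 : lT -> gT)
    (i3 : gT -> lT) (a : drinfeld k gT) :
  (forall x, p1 (p2 x) = p3 x) -> (forall y, i2 (i1 y) = i3 y) ->
  pull p2 i2 (pull p1 i1 a) = pull p3 i3 a.
Proof.
move=> p12 i12; apply: cfP => x y; rewrite !cfE.
under eq_bigr do rewrite cfE p12.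
rewrite (exchange_big_dep (fun z => i3 z == y)) /= => [|z t /eqP <- /eqP <-].
  apply: eq_bigr => z /eqP <-.
  rewrite (bigD1 (i1 z)) ?i12 ?eqxx //= big1 ?addr0 // => t.
  by rewrite andbC => /andP[] /negbTE; rewrite eq_sym => ->; rewrite andbF.
by rewrite i12.
Qed.

(** Meant for maps into complementary tensor factors: their group parts commute, and each fixes the
    functions that come from the other. *)
Lemma pull_comm (k : fieldType) (gT hT lT : finGroupType) (p1 : lT -> gT)
    (i1 : gT -> lT) (p2 : lT -> hT) (i2 : hT -> lT) (a : drinfeld k gT)
    (b : drinfeld k hT) :
  (forall x y, commute (i1 x) (i2 y)) ->
  (forall x y, p1 (x ^ i2 y)%g = p1 x) -> (forall x y, p2 (x ^ i1 y)%g = p2 x) ->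
  pull p1 i1 a * pull p2 i2 b = pull p2 i2 b * pull p1 i1 a.
Proof.
move=> i12C p1J p2J; apply: cfP => x y; rewrite cf_pull_mul cf_mul_pull.
apply: eq_bigr => z _; rewrite !cfE p2J mulr_sumr mulr_suml.
apply: eq_big => [t|t /eqP def_t]; last rewrite mulrC.
  rewrite -(inj_eq (mulgI (i1 z))) mulKVg -[RHS](inj_eq (mulIg (i1 z))).
  by rewrite mulgKV i12C.
have -> : (y * (i1 z)^-1)%g = i2 t; last by rewrite p1J.
by apply: (mulIg (i1 z)); rewrite mulgKV -i12C def_t mulKVg.
Qed.

(** * Tensor powers of the double, twists and gauge transformations *)

Section Tensor.

Variables (k : fieldType) (gT : finGroupType).
Local Notation D1 := (drinfeld k gT).
Local Notation D2 := (drinfeld k (gT * gT)%type).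
Local Notation D3 := (drinfeld k (gT * gT * gT)%type).

(** The tensor square of the double of [gT] is encoded as the double of [gT * gT], and the cube
    likewise. In [dcomul], e_x goes to the sum of the e_x1 \otimes e_x2 with x1 x2 = x, and y goes
    to y \otimes y. *)
Definition dinl : D1 -> D2 := pull (fun x => x.1) (fun y => (y, 1%g)).
Definition dinr : D1 -> D2 := pull (fun x => x.2) (fun y => (1%g, y)).
Definition dcomul : D1 -> D2 := pull (fun x => x.1 * x.2)%g (fun y => (y, y)).
Definition dswap : D2 -> D2 :=
  pull (fun x => (x.2, x.1)) (fun y => (y.2, y.1)).
Definition din12 : D2 -> D3 := pull (fun x => x.1) (fun y => (y, 1%g)).
Definition din23 : D2 -> D3 :=
  pull (fun x => (x.1.2, x.2)) (fun y => (1%g, y.1, y.2)).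
Definition dcomul12 : D2 -> D3 :=
  pull (fun x => (x.1.1 * x.1.2, x.2)%g) (fun y => (y.1, y.1, y.2)).
Definition dcomul23 : D2 -> D3 :=
  pull (fun x => (x.1.1, x.1.2 * x.2)%g) (fun y => (y.1, y.2, y.2)).

Lemma pairM (aT bT : finGroupType) (x1 y1 : aT) (x2 y2 : bT) :
  ((x1, x2) * (y1, y2))%g = (x1 * y1, x2 * y2)%g.
Proof. by []. Qed.

Lemma pair1 (aT bT : finGroupType) : (1%g : (aT * bT)%type) = (1, 1)%g.
Proof. by []. Qed.

Lemma pairV (aT bT : finGroupType) (x1 : aT) (x2 : bT) :
  ((x1, x2)^-1)%g = (x1^-1, x2^-1)%g.
Proof. by []. Qed.

Lemma pairJ (aT bT : finGroupType) (x1 y1 : aT) (x2 y2 : bT) :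
  ((x1, x2) ^ (y1, y2))%g = (x1 ^ y1, x2 ^ y2)%g.
Proof. by []. Qed.

Lemma dinlM : {morph dinl : a b / a * b}.
Proof.
by apply: pullM => [x y|[x1 x2] y]; rewrite ?pairM ?mulg1.
Qed.
Lemma dinl1 : dinl 1 = 1.
Proof. by apply: pull1 => x y; rewrite pairM mulg1. Qed.
Lemma dinrM : {morph dinr : a b / a * b}.
Proof.
by apply: pullM => [x y|[x1 x2] y]; rewrite ?pairM ?mulg1.
Qed.
Lemma dinr1 : dinr 1 = 1.
Proof. by apply: pull1 => x y; rewrite pairM mulg1. Qed.
Lemma dcomulM : {morph dcomul : a b / a * b}.
Proof. by apply: pullM => [x y|[x1 x2] y] //=; rewrite conjMg. Qed.
Lemma dcomul1 : dcomul 1 = 1.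
Proof. by apply: pull1. Qed.
Lemma dswapM : {morph dswap : a b / a * b}.
Proof. by apply: pullM => [x y|[x1 x2] [y1 y2]]. Qed.
Lemma din12M : {morph din12 : a b / a * b}.
Proof. by apply: pullM => [x y|[x1 x2] y]; rewrite ?pairM ?mulg1. Qed.
Lemma din23M : {morph din23 : a b / a * b}.
Proof. by apply: pullM => [x y|[[x1 x2] x3] [y1 y2]]; rewrite ?pairM ?mulg1. Qed.
Lemma dcomul12M : {morph dcomul12 : a b / a * b}.
Proof. by apply: pullM => [x y|[[x1 x2] x3] [y1 y2]] //=; rewrite !pairJ /= conjMg. Qed.
Lemma dcomul23M : {morph dcomul23 : a b / a * b}.
Proof. by apply: pullM => [x y|[[x1 x2] x3] [y1 y2]] //=; rewrite !pairJ /= conjMg. Qed.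

Lemma dinlrC a b : dinl a * dinr b = dinr b * dinl a.
Proof.
apply: pull_comm => [x y|[x1 x2] y|[x1 x2] y] //=.
  by rewrite /commute !pairM !mulg1 !mul1g.
all: exact: conjg1.
Qed.

(** The Drinfeld twist equation (F \otimes 1)(Delta \otimes id)(F) = (1 \otimes F)(id \otimes
    Delta)(F). *)
Definition dcocycle (F : D2) := din12 F * dcomul12 F = din23 F * dcomul23 F.

Definition gauge (w w' : D1) (F : D2) := dinl w' * dinr w' * F * dcomul w.

(** In the tensor cube, Delta(w) meets Delta(w') and cancels, and elements of distinct legs commute.
    Each side thus becomes the same side for F, multiplied by w' in all three legs on the left and
    by the iterated coproduct of w on the right. *)
Lemma gauge_cocycle w w' F :
  w * w' = 1 -> dcocycle F -> dcocycle (gauge w w' F).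
Proof.
move=> ww' cocF; rewrite /dcocycle /gauge !(din12M, din23M, dcomul12M, dcomul23M).
(* Cosimplicial identities: two composites into the tensor cube agree once their underlying maps of
   groups do. *)
have e1 a : dcomul23 (dinl a) = din12 (dinl a).
  rewrite /dcomul23 /din12 /dinl.
  by rewrite !(pull_comp (p3 := fun x => x.1.1) (i3 := fun y => (y, 1, 1)%g)).
have e2 a : din23 (dinl a) = din12 (dinr a).
  rewrite /din23 /din12 /dinl /dinr.
  by rewrite !(pull_comp (p3 := fun x => x.1.2) (i3 := fun y => (1, y, 1)%g)).
have e3 a : din23 (dinr a) = dcomul12 (dinr a).
  rewrite /din23 /dcomul12 /dinr.
  by rewrite !(pull_comp (p3 := fun x => x.2) (i3 := fun y => (1, 1, y)%g)).
have e12 a : dcomul12 (dinl a) = din12 (dcomul a).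
  rewrite /din12 /dcomul12 /dinl /dcomul.
  by rewrite !(pull_comp (p3 := fun x => (x.1.1 * x.1.2)%g) (i3 := fun y => (y, y, 1)%g)).
have e23 a : dcomul23 (dinr a) = din23 (dcomul a).
  rewrite /din23 /dcomul23 /dinr /dcomul.
  by rewrite !(pull_comp (p3 := fun x => (x.1.2 * x.2)%g) (i3 := fun y => (1, y, y)%g)).
have e123 a : dcomul12 (dcomul a) = dcomul23 (dcomul a).
  rewrite /dcomul23 /dcomul12 /dcomul.
  rewrite !(pull_comp (p3 := fun x => (x.1.1 * x.1.2 * x.2)%g)
                      (i3 := fun y => (y, y, y)%g)) //.
  by move=> x /=; rewrite mulgA.
have C3 : forall a H, din12 H * dcomul12 (dinr a) = dcomul12 (dinr a) * din12 H.
  move=> a H; rewrite -e3 /din12 /din23 /dinr.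
  rewrite !(pull_comp (p3 := fun x => x.2) (i3 := fun y => (1, 1, y)%g)) //.
  apply: pull_comm => [x y|[[x1 x2] x3] y|[[x1 x2] x3] y] /=.
  - by rewrite /commute !pairM !mulg1 !mul1g.
  - by congr (_, _); apply: conjg1.
  exact: conjg1.
have C1 : forall a H, din23 H * din12 (dinl a) = din12 (dinl a) * din23 H.
  move=> a H; rewrite -e1 /din23 /dcomul23 /dinl.
  rewrite !(pull_comp (p3 := fun x => x.1.1) (i3 := fun y => (y, 1, 1)%g)) //.
  apply: pull_comm => [x y|[[x1 x2] x3] y|[[x1 x2] x3] y] //=.
  - by rewrite /commute !pairM !mulg1 !mul1g.
  - by congr (_, _); apply: conjg1.
  exact: conjg1.
have dd : dcomul w * dcomul w' = 1 by rewrite -dcomulM ww' dcomul1.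
have dl H : din12 (dcomul w) * (din12 (dcomul w') * H) = H.
  by rewrite mulrA -din12M dd /din12 pull1 ?mul1r // => x y; rewrite pairM mulg1.
have dr H : din23 (dcomul w) * (din23 (dcomul w') * H) = H.
  by rewrite mulrA -din23M dd /din23 pull1 ?mul1r // => x y; rewrite !pairM mulg1.
have lhs : din12 (dinl w') * din12 (dinr w') * din12 F * din12 (dcomul w) *
    (dcomul12 (dinl w') * dcomul12 (dinr w') * dcomul12 F * dcomul12 (dcomul w))
    = din12 (dinl w') * din12 (dinr w') * dcomul12 (dinr w') *
      (din12 F * dcomul12 F) * dcomul23 (dcomul w).
  by rewrite e12 e123 -!mulrA dl [din12 F * (dcomul12 (dinr w') * _)]mulrA C3 !mulrA.
have C1' H L : din23 H * (din12 (dinl w') * L) = din12 (dinl w') * (din23 H * L).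
  by rewrite mulrA C1 mulrA.
by rewrite lhs cocF e1 e23 -e2 -e3 -!mulrA !C1' dr.
Qed.

Lemma sum_pair (aT bT : finType) (f : aT * bT -> k) :
  \sum_z f z = \sum_a \sum_b f (a, b).
Proof. by rewrite pair_bigA; apply: eq_bigr => -[]. Qed.

Lemma sum_pair1 (V : nmodType) (aT bT : finType) (f : aT -> bT -> V) a b :
  (forall z t, (z, t) != (a, b) -> f z t = 0) -> \sum_z \sum_t f z t = f a b.
Proof.
move=> f0; rewrite pair_bigA (bigD1 (a, b)) //= big1 ?addr0 // => -[z t].
exact: f0.
Qed.

Lemma cf_cocyclel (F : D2) x1 x2 x3 y1 y2 y3 :
  cf (din12 F * dcomul12 F) (x1, x2, x3) (y1, y2, y3) =
  \sum_z1 \sum_z2 cf F (x1, x2) (z1, z2) *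
    ((z1^-1 * y1 == z2^-1 * y2)%g%:R *
     cf F (x1 ^ z1 * x2 ^ z2, x3)%g (z1^-1 * y1, y3)%g).
Proof.
rewrite cf_pull_mul sum_pair; apply: eq_bigr => z1 _; apply: eq_bigr => z2 _.
congr (_ * _); rewrite /dcomul12 (cf_pull _ (j := fun y => (y.1.1, y.2))) => [|[]//].
by rewrite !(pairV, pairM, pairJ) /= conjg1 invg1 mul1g !xpair_eqE !eqxx ?andbT /=.
Qed.

Lemma cf_cocycler (F : D2) x1 x2 x3 y1 y2 y3 :
  cf (din23 F * dcomul23 F) (x1, x2, x3) (y1, y2, y3) =
  \sum_z1 \sum_z2 cf F (x2, x3) (z1, z2) *
    ((z1^-1 * y2 == z2^-1 * y3)%g%:R *
     cf F (x1, x2 ^ z1 * x3 ^ z2)%g (y1, z1^-1 * y2)%g).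
Proof.
rewrite cf_pull_mul sum_pair; apply: eq_bigr => z1 _; apply: eq_bigr => z2 _.
congr (_ * _); rewrite /dcomul23 (cf_pull _ (j := fun y => (y.1.1, y.1.2))) => [|[]//].
by rewrite !(pairV, pairM, pairJ) /= conjg1 invg1 mul1g !xpair_eqE !eqxx /=.
Qed.

End Tensor.

(** * Bilinear forms on DG^* as elements of the tensor square, and the R-matrix *)

Section Twist.

Variables (k : fieldType) (gT : finGroupType).
Local Notation H := (dualdouble k gT).
Local Notation D1 := (drinfeld k gT).
Local Notation D2 := (drinfeld k (gT * gT)%type).
Local Notation elt := (dd_elt k).
Implicit Types (sigma tau : {biscalar H}).

(* A form sigma on the tensor square of DG^* is an element of the tensor square
   of the Drinfeld double, and convolution becomes the product. *)
Definition twist sigma : D2 :=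
  mkD (fun x y => sigma (elt x.1 y.1) (elt x.2 y.2)).

Lemma twistE sigma x1 x2 y1 y2 :
  cf (twist sigma) (x1, x2) (y1, y2) = sigma (elt x1 y1) (elt x2 y2).
Proof. exact: cfE. Qed.

Lemma twistM sigma tau x1 x2 y1 y2 :
  cf (twist sigma * twist tau) (x1, x2) (y1, y2) =
  conv2 sigma tau (elt x1 y1) (elt x2 y2).
Proof.
rewrite cfM /conv2 sum_pair sweedler_elt; apply: eq_bigr => z1 _.
rewrite sweedler_elt; apply: eq_bigr => z2 _.
by rewrite !cfE.
Qed.

Lemma twistV sigma tau :
  conv_inverse2 sigma tau ->
  twist sigma * twist tau = 1 /\ twist tau * twist sigma = 1.
Proof.
move=> inv_st; split; apply: cfP => -[x1 x2] [y1 y2]; rewrite twistM cf1 xpair_eqE.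
  by rewrite (inv_st _ _).1 !dd_counit_elt -natrM mulnb.
by rewrite (inv_st _ _).2 !dd_counit_elt -natrM mulnb.
Qed.

Lemma cocycle_elt_l sigma x1 x2 x3 y1 y2 y3 :
  \sw_(a1, a2 <- elt x1 y1) \sw_(b1, b2 <- elt x2 y2)
    (sigma a1 b1 * sigma (a2 * b2) (elt x3 y3) : k^o) =
  cf (din12 (twist sigma) * dcomul12 (twist sigma)) (x1, x2, x3) (y1, y2, y3).
Proof.
rewrite cf_cocyclel sweedler_elt; apply: eq_bigr => z1 _.
rewrite sweedler_elt; apply: eq_bigr => z2 _.
by rewrite !twistE dd_mul_elt linearZl_LR.
Qed.

Lemma cocycle_elt_r sigma x1 x2 x3 y1 y2 y3 :
  \sw_(b1, b2 <- elt x2 y2) \sw_(c1, c2 <- elt x3 y3)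
    (sigma b1 c1 * sigma (elt x1 y1) (b2 * c2) : k^o) =
  cf (din23 (twist sigma) * dcomul23 (twist sigma)) (x1, x2, x3) (y1, y2, y3).
Proof.
rewrite cf_cocycler sweedler_elt; apply: eq_bigr => z1 _.
rewrite sweedler_elt; apply: eq_bigr => z2 _.
by rewrite !twistE dd_mul_elt linearZr_LR.
Qed.

Lemma twist_cocycle sigma : Z2 sigma -> dcocycle (twist sigma).
Proof.
case=> _ _ coc; apply: cfP => -[[x1 x2] x3] [[y1 y2] y3].
by rewrite -cocycle_elt_l -cocycle_elt_r coc.
Qed.

(** Laziness means that the twist commutes with the image of the coproduct of D. Summing the
    coordinates at the (x, c) is pairing with the group-like element c, whose coproduct is c \otimes
    c; a single splitting of the arguments then survives on each side. *)
Lemma twist_lazy sigma x1 x2 y1 y2 c : lazy_cocycle sigma ->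
  cf (twist sigma) (x1 ^ c, x2 ^ c)%g (y1 ^ c, y2 ^ c)%g =
  cf (twist sigma) (x1, x2) (y1, y2).
Proof.
move=> lazy.
have := lazy (elt x1 (y1 * c)%g) (elt x2 (y2 * c)%g).
move/(congr1 (fun a => \sum_x dd_coord a (x, c))).
have coordE (u : H) x : dd_coord u (x, c) = (u : {ffun _ -> k^o}) (x, c) by [].
pose L (u : H) : k := \sum_x dd_coord u (x, c).
have LZ r u : L (r *: u) = r * L u.
  by rewrite /L mulr_sumr; apply: eq_bigr => x _; rewrite dd_coordZ.
have Lsum (I : finType) (f : I -> H) : L (\sum_i f i) = \sum_i L (f i).
  by rewrite /L exchange_big; apply: eq_bigr => x _; rewrite dd_coord_sum.
have LM u1 v1 u2 v2 :
    L (elt u1 v1 * elt u2 v2) = ((v1 == v2) && (v1 == c))%:R.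
  rewrite dd_mul_elt LZ /L (bigD1 (u1 * u2)%g) //= big1 ?addr0.
    by rewrite dd_coord_elt xpair_eqE eqxx /= -natrM mulnb [c == _]eq_sym.
  by move=> x /negbTE nx; rewrite dd_coord_elt xpair_eqE nx.
rewrite -![\sum_x dd_coord _ _]/(L _) !sweedler_elt !Lsum.
under eq_bigr do rewrite sweedler_elt Lsum.
under [RHS]eq_bigr do rewrite sweedler_elt Lsum.
have cancel_eq (z y : gT) : (z^-1 * (y * c) = c)%g -> z = y.
  by move=> def_c; apply: (mulIg c); rewrite -[in LHS]def_c mulKVg.
rewrite (sum_pair1 (a := y1) (b := y2)) => [|z t]; last first.
  move=> nzt; rewrite LZ LM; case: eqP => [eq_zt|_]; last by rewrite mulr0.
  case: eqP => [def_c|]; last by rewrite mulr0.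
  by rewrite (cancel_eq z y1) // (cancel_eq t y2) ?eqxx -?eq_zt in nzt.
rewrite LZ LM !mulKg !eqxx mulr1 !twistE => ->.
rewrite (sum_pair1 (a := c) (b := c)) => [|z t]; last first.
  move=> nzt; rewrite LZ LM; case: eqP => [eq_zt|_]; last by rewrite mulr0.
  case: eqP => [def_c|]; last by rewrite mulr0.
  by rewrite -eq_zt def_c eqxx in nzt.
by rewrite LZ LM !eqxx mulr1 /conjg !mulgA.
Qed.

(* The universal R-matrix \sum_g e_g \otimes g. *)
Definition Rmx : D2 := mkD (fun x y => ((y.1 == 1) && (y.2 == x.1))%g%:R).

Lemma cf_Rl (F : D2) x1 x2 y1 y2 :
  cf (Rmx * F) (x1, x2) (y1, y2) = cf F (x1, x2 ^ x1)%g (y1, x1^-1 * y2)%g.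
Proof.
rewrite cfM (bigD1 (1, x1)%g) //= big1 ?addr0; last first.
  by move=> [z1 z2] /negbTE; rewrite xpair_eqE cfE /= => ->; rewrite mul0r.
by rewrite cfE !eqxx mul1r pairJ conjg1 pairV pairM invg1 mul1g.
Qed.

Lemma cf_Rr (F : D2) x1 x2 y1 y2 :
  cf (F * Rmx) (x1, x2) (y1, y2) = cf F (x1, x2) (y1, y2 * (x1^-1 ^ y1))%g.
Proof.
rewrite cfM (bigD1 (y1, y2 * (x1^-1 ^ y1))%g) //= big1 ?addr0.
  by rewrite cfE /= mulVg eqxx invMg mulgKV conjVg invgK eqxx mulr1.
move=> [z1 z2] nz; rewrite cfE pairJ pairV pairM /=.
case: (_ =P 1%g) => [def_y1|]; last by rewrite mulr0.
case: (_ =P (x1 ^ z1)%g) => [def_y2|]; last by rewrite mulr0.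
have def_z1 : z1 = y1 by rewrite -[RHS](mulKVg z1) def_y1 mulg1.
by rewrite conjVg -def_z1 -def_y2 invMg invgK mulKVg eqxx in nz.
Qed.

Lemma cf_swap (F : D2) x1 x2 y1 y2 :
  cf (dswap F) (x1, x2) (y1, y2) = cf F (x2, x1) (y2, y1).
Proof.
rewrite /dswap (cf_pull _ (j := fun y => (y.2, y.1))) => [|[]//].
by rewrite eqxx mul1r.
Qed.

Lemma cf_comul (a : D1) x1 x2 y1 y2 :
  cf (dcomul a) (x1, x2) (y1, y2) = (y1 == y2)%:R * cf a (x1 * x2)%g y1.
Proof.
rewrite /dcomul (cf_pull _ (j := fun y => y.1)) => [|//].
by rewrite xpair_eqE eqxx.
Qed.

Lemma cf_inl (a : D1) x1 x2 y1 y2 :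
  cf (dinl a) (x1, x2) (y1, y2) = (y2 == 1%g)%:R * cf a x1 y1.
Proof.
rewrite /dinl (cf_pull _ (j := fun y => y.1)) => [|//].
by rewrite xpair_eqE eqxx [_ == y2]eq_sym.
Qed.

Lemma cf_inl_mul (a : D1) (F : D2) x1 x2 y1 y2 :
  cf (dinl a * F) (x1, x2) (y1, y2) =
  \sum_z cf a x1 z * cf F (x1 ^ z, x2)%g (z^-1 * y1, y2)%g.
Proof.
rewrite cf_pull_mul; apply: eq_bigr => z _.
by rewrite pairJ pairV pairM conjg1 invg1 mul1g.
Qed.

Lemma cf_tens (a b : D1) x1 x2 y1 y2 :
  cf (dinl a * dinr b) (x1, x2) (y1, y2) = cf a x1 y1 * cf b x2 y2.
Proof.
rewrite cf_inl_mul (bigD1 y1) //= big1 ?addr0 => [|z nz].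
  rewrite /dinr (cf_pull _ (j := fun y => y.2)) => [|//].
  by rewrite xpair_eqE mulVg !eqxx mul1r.
rewrite /dinr (cf_pull _ (j := fun y => y.2)) => [|//].
rewrite xpair_eqE eqxx andbT; case: eqP => [def_z|]; last by rewrite mul0r mulr0.
by case/eqP: nz; apply: (mulgI z^-1%g); rewrite -def_z mulVg.
Qed.

(** In coordinates this is the symmetry condition with [g^-1 * s] in the role of [s]. *)
Lemma twist_sym sigma : symmetric_cocycle sigma ->
  Rmx * twist sigma = dswap (twist sigma) * Rmx.
Proof.
move=> sym; apply: cfP => -[g h] [t s]; rewrite cf_Rl cf_Rr cf_swap !twistE.
by rewrite sym mulKVg.
Qed.

Lemma cf_comul_mul (a : D1) (F : D2) x1 x2 y1 y2 :
  cf (dcomul a * F) (x1, x2) (y1, y2) =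
  \sum_z cf a (x1 * x2)%g z * cf F (x1 ^ z, x2 ^ z)%g (z^-1 * y1, z^-1 * y2)%g.
Proof. exact: cf_pull_mul. Qed.

Lemma cf_mul_comul (a : D1) (F : D2) x1 x2 y1 y2 :
  cf (F * dcomul a) (x1, x2) (y1, y2) =
  \sum_z cf F (x1, x2) (y1 * z^-1, y2 * z^-1)%g *
         cf a (x1 ^ (y1 * z^-1) * x2 ^ (y2 * z^-1))%g z.
Proof.
exact: cf_mul_pull.
Qed.

End Twist.

(** * Commuting matrices and symmetric twists of kG *)

Section CommonEigenvector.

Variables (k : closedFieldType) (n : nat).

(** The linear factors A - z of the characteristic polynomial are applied one by one to a nonzero
    vector of U. Their product kills it, so some factor kills a vector that is still nonzero and
    still in U. *)
Lemma stable_eigenvalue (A U : 'M[k]_n.+1) :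
  U != 0 -> (U *m A <= U)%MS -> exists a, (U :&: eigenspace A a)%MS != 0.
Proof.
move=> nzU UA; have [s def_p] := closed_field_poly_normal (char_poly A).
have /eqP := Cayley_Hamilton A.
rewrite def_p (monicP (char_poly_monic A)) scale1r => /eqP Cs.
have [v vU nzv] := rowV0Pn nzU.
have {Cs}: v *m horner_mx A (\prod_(z <- s) ('X - z%:P)) = 0 by rewrite Cs mulmx0.
elim: s v vU nzv {def_p} => [|z s IHs] v vU nzv.
  by rewrite big_nil rmorph1 mulmx1 => v0; rewrite v0 eqxx in nzv.
rewrite big_cons rmorphM mulmxA; have [Az0 _|nzAz] := eqVneq (v *m (A - z%:M)) 0.
  exists z; apply/rowV0Pn; exists v => //; rewrite sub_capmx vU.
  apply/eigenspaceP; apply/eqP.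
  by rewrite -subr_eq0 -mul_mx_scalar -mulmxBr Az0.
rewrite rmorphB /= horner_mx_X horner_mx_C; apply: IHs => //.
rewrite mulmxBr addmx_sub ?eqmx_opp //; first by rewrite (submx_trans _ UA) ?submxMr.
by rewrite mul_mx_scalar scalemx_sub.
Qed.

(** Induction on the rank of a stable subspace U: either every A i is scalar on U, or some
    eigenspace cuts U properly, and the intersection is nonzero and stable because the A i
    commute. *)
Lemma common_eigenvector_fam (I : finType) (A : I -> 'M[k]_n.+1) :
  (forall i j, A i *m A j = A j *m A i) ->
  exists2 v : 'rV_n.+1, v != 0 & exists a : I -> k, forall i, v *m A i = a i *: v.
Proof.
move=> AC.
suff main r (U : 'M[k]_n.+1) : (\rank U <= r)%N -> U != 0 ->
    (forall i, U *m A i <= U)%MS ->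
    exists2 v : 'rV_n.+1, v != 0 & exists a : I -> k, forall i, v *m A i = a i *: v.
  by apply: (main n.+1 1%:M); rewrite ?rank_leq_row ?oner_eq0 // => i; apply: submx1.
elim: r U => [|r IHr] U; first by rewrite leqn0 mxrank_eq0 => ->.
move=> rU nzU UA.
have /fin_all_exists[a nzUa] i := stable_eigenvalue nzU (UA i).
have [/forallP Uall|] := boolP [forall i, (U <= eigenspace (A i) (a i))%MS].
  have [v vU nzv] := rowV0Pn nzU; exists v => //; exists a => i.
  exact/eigenspaceP/(submx_trans vU).
rewrite negb_forall => /existsP[i nUi].
apply: (IHr (U :&: eigenspace (A i) (a i))%MS) => // [|j].
  rewrite -ltnS; apply: leq_trans rU; rewrite ltn_neqAle mxrankS ?capmxSl // andbT.
  apply: contra nUi; rewrite (mxrank_leqif_sup (capmxSl _ _)).2 sub_capmx.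
  by case/andP.
rewrite sub_capmx (submx_trans _ (UA j)) ?submxMr ?capmxSl //=.
apply/eigenspaceP; rewrite -mulmxA AC mulmxA.
have /eigenspaceP-> : (U :&: eigenspace (A i) (a i) <= eigenspace (A i) (a i))%MS.
  exact: capmxSr.
by rewrite scalemxAl.
Qed.

End CommonEigenvector.

(* A symmetric Drinfeld twist J of the group algebra is a coboundary: u is a
   character of the commutative algebra with structure constants
   J (s c^-1) (t c^-1). *)
Lemma symmetric_twist_trivial (k : closedFieldType) (gT : finGroupType)
    (J : gT -> gT -> k) :
  (forall s t, J s t = J t s) ->
  (forall t, \sum_s J s t = (t == 1%g)%:R) ->
  (forall s t r, \sum_c J (s * c^-1)%g (t * c^-1)%g * J c r =
                 \sum_c J (t * c^-1)%g (r * c^-1)%g * J s c) ->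
  exists2 u : gT -> k, \sum_s u s = 1 &
    forall s t, \sum_c J (s * c^-1)%g (t * c^-1)%g * u c = u s * u t.
Proof.
move=> Jsym J1 JA.
have [n def_n] : exists n, #|gT| = n.+1.
  by exists #|gT|.-1; rewrite prednK //; apply/card_gt0P; exists 1%g.
pose f (i : 'I_n.+1) : gT := enum_val (cast_ord (esym def_n) i).
have f_bij : bijective f.
  exists (fun x => cast_ord def_n (enum_rank x)) => x; rewrite /f.
    by rewrite enum_valK cast_ordKV.
  by rewrite cast_ordK enum_rankK.
(* The matrix of multiplication by s in the algebra with product s . t = \sum_c J (s c^-1) (t c^-1)
   c, so that [AM] is its associativity. *)
pose A s := \matrix_(i < n.+1, j < n.+1) J (s * (f i)^-1)%g (f j * (f i)^-1)%g.
have AM s t : A s *m A t = \sum_c J (s * c^-1)%g (t * c^-1)%g *: A c.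
  apply/matrixP => i j; rewrite mxE summxE.
  under eq_bigr do rewrite !mxE mulrC.
  under [RHS]eq_bigr do rewrite !mxE.
  pose G c := J (t * c^-1)%g (f j * c^-1)%g * J (s * (f i)^-1)%g (c * (f i)^-1)%g.
  rewrite -(reindex f (P := predT) (F := G)) /=; last exact: onW_bij.
  have := JA (s * (f i)^-1)%g (t * (f i)^-1)%g (f j * (f i)^-1)%g.
  rewrite (reindex_inj (mulIg (f i)^-1%g)) [RHS](reindex_inj (mulIg (f i)^-1%g)) /=.
  rewrite /G; under eq_bigr do rewrite !invMg !invgK !mulgA !mulgKV.
  move=> ->; apply: eq_bigr => c _.
  by rewrite !invMg !invgK !mulgA !mulgKV.
have AC s t : A s *m A t = A t *m A s.
  by rewrite !AM; apply: eq_bigr => c _; rewrite Jsym.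
(* The eigenvalues u s are multiplicative by [AM]. The normalization of J says that the sum of the A
   s is the identity, hence that the u s add up to 1. *)
have [v nzv [u Av]] := common_eigenvector_fam AC.
have v_inj a b : a *: v = b *: v -> a = b.
  by move/eqP; rewrite -subr_eq0 -scalerBl scaler_eq0 (negbTE nzv) orbF subr_eq0 => /eqP.
exists u => [|s t]; apply: v_inj.
  rewrite scale1r scaler_suml; under eq_bigr do rewrite -Av.
  rewrite -mulmx_sumr -[RHS]mulmx1; congr (_ *m _); apply/matrixP => i j.
  rewrite summxE !mxE; under eq_bigr do rewrite mxE.
  rewrite (reindex_inj (mulIg (f i))) /=; under eq_bigr do rewrite mulgK.
  by rewrite J1 -(inj_eq (mulIg (f i))) mulgKV mul1g (bij_eq f_bij) eq_sym.
transitivity (v *m (A s *m A t)); last first.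
  by rewrite mulmxA Av -scalemxAl Av scalerA.
rewrite AM mulmx_sumr scaler_suml; apply: eq_bigr => c _.
by rewrite -scalemxAr Av scalerA.
Qed.

(** * Gauge calculus, projections onto kG, invariance and group-like elements *)

Section Gauge.

Variables (k : fieldType) (gT : finGroupType).
Local Notation D1 := (drinfeld k gT).
Local Notation D2 := (drinfeld k (gT * gT)%type).
Implicit Types (a b w : D1) (X Y F G : D2).

(* a \otimes a *)
Definition dtens a : D2 := mkD (fun x y => cf a x.1 y.1 * cf a x.2 y.2).

Lemma dtensE a : dtens a = dinl a * dinr a.
Proof. by apply: cfP => -[x1 x2] [y1 y2]; rewrite cf_tens cfE. Qed.

Lemma dtensM : {morph dtens : a b / a * b}.
Proof.
move=> a b; rewrite !dtensE dinlM dinrM -!mulrA; congr (_ * _).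
by rewrite !mulrA dinlrC.
Qed.

Lemma dtens1 : dtens 1 = 1.
Proof. by rewrite dtensE dinl1 dinr1 mulr1. Qed.

Lemma cf_dtens a x1 x2 y1 y2 :
  cf (dtens a) (x1, x2) (y1, y2) = cf a x1 y1 * cf a x2 y2.
Proof. exact: cfE. Qed.

Definition inverse_pair (R : nzRingType) (a b : R) := a * b = 1 /\ b * a = 1.

Lemma gaugeE w w' F : inverse_pair w w' -> dtens w * gauge w w' F = F * dcomul w.
Proof.
case=> ww' _; rewrite /gauge -dtensE !mulrA -dtensM ww'.
by rewrite dtens1 mul1r.
Qed.

Lemma gauge_inv w w' F F' : inverse_pair w w' -> inverse_pair F F' ->
  inverse_pair (gauge w w' F) (dcomul w' * F' * dtens w).
Proof.
case=> ww' w'w [FF' F'F]; rewrite /gauge -dtensE; split.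
  rewrite !mulrA -[_ * dcomul w * _]mulrA -dcomulM ww' dcomul1 mulr1.
  by rewrite -[_ * F * _]mulrA FF' mulr1 -dtensM w'w dtens1.
rewrite !mulrA -[_ * dtens w * _]mulrA -dtensM ww' dtens1 mulr1.
by rewrite -[_ * F' * _]mulrA F'F mulr1 -dcomulM w'w dcomul1.
Qed.

Lemma gauge_comp w w' v v' F :
  gauge v v' (gauge w w' F) = gauge (w * v) (v' * w') F.
Proof. by rewrite /gauge -!dtensE dtensM dcomulM !mulrA. Qed.

Definition e1 : D1 := dfun (fun x => (x == 1%g)%:R).
(* The central idempotents e_1 \otimes 1 and 1 \otimes e_1: multiplying by one
   of them amounts to projecting the corresponding factor of the tensor square
   onto its quotient kG, where e_x |-> (x == 1). *)
Definition E1 : D2 := dfun (fun x => (x.1 == 1%g)%:R).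
Definition E2 : D2 := dfun (fun x => (x.2 == 1%g)%:R).

Lemma dfun_central (hT : finGroupType) f (a : drinfeld k hT) :
  (forall x y, f (x ^ y)%g = f x) -> dfun f * a = a * dfun f.
Proof. by move=> fJ; apply: cfP => x y; rewrite cf_dfunl cf_dfunr fJ mulrC. Qed.

Lemma conjg_eq1l (hT : finGroupType) (x y : hT) : ((x ^ y)%g == 1%g) = (x == 1%g).
Proof. by rewrite -(inj_eq (conjg_inj y) x) conj1g. Qed.

Lemma e1C a : e1 * a = a * e1.
Proof. by apply: dfun_central => x y; rewrite conjg_eq1l. Qed.
Lemma E1C X : E1 * X = X * E1.
Proof. by apply: dfun_central => -[x1 x2] [y1 y2]; rewrite pairJ conjg_eq1l. Qed.
Lemma E2C X : E2 * X = X * E2.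
Proof. by apply: dfun_central => -[x1 x2] [y1 y2]; rewrite pairJ conjg_eq1l. Qed.

Lemma E12C X : E1 * E2 * X = X * (E1 * E2).
Proof. by rewrite -mulrA [E2 * X]E2C [RHS]mulrA -[X * E1]E1C mulrA. Qed.

Lemma e1P a b : (forall y, cf a 1%g y = cf b 1%g y) <-> a * e1 = b * e1.
Proof.
rewrite -!e1C; split=> [eq_ab|eq_ab y].
  apply: cfP => x y; rewrite !cf_dfunl.
  by case: eqP => [->|]; rewrite ?mul0r ?eq_ab.
by have := congr1 (fun a => cf a 1%g y) eq_ab; rewrite !cf_dfunl eqxx !mul1r.
Qed.

Lemma E1P X Y :
  (forall x y1 y2, cf X (1%g, x) (y1, y2) = cf Y (1%g, x) (y1, y2)) <->
  X * E1 = Y * E1.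
Proof.
rewrite -!E1C; split=> [eqXY|eqXY x y1 y2].
  apply: cfP => -[x1 x2] [y1 y2]; rewrite !cf_dfunl /=.
  by case: eqP => [->|]; rewrite ?mul0r ?eqXY.
by have := congr1 (fun X => cf X (1%g, x) (y1, y2)) eqXY; rewrite !cf_dfunl eqxx !mul1r.
Qed.

Lemma E2P X Y :
  (forall x y1 y2, cf X (x, 1%g) (y1, y2) = cf Y (x, 1%g) (y1, y2)) <->
  X * E2 = Y * E2.
Proof.
rewrite -!E2C; split=> [eqXY|eqXY x y1 y2].
  apply: cfP => -[x1 x2] [y1 y2]; rewrite !cf_dfunl /=.
  by case: eqP => [->|]; rewrite ?mul0r ?eqXY.
by have := congr1 (fun X => cf X (x, 1%g) (y1, y2)) eqXY; rewrite !cf_dfunl eqxx !mul1r.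
Qed.

Lemma E12P X Y :
  (forall y1 y2, cf X (1%g, 1%g) (y1, y2) = cf Y (1%g, 1%g) (y1, y2)) <->
  X * (E1 * E2) = Y * (E1 * E2).
Proof.
rewrite !mulrA -!E2C -!E1C; split=> [eqXY|eqXY y1 y2].
  apply: cfP => -[x1 x2] [y1 y2]; rewrite !cf_dfunl /=.
  case: eqP => [->|]; rewrite ?mul0r ?mulr0 //.
  by case: eqP => [->|]; rewrite ?mul0r ?eqXY.
have := congr1 (fun X => cf X (1%g, 1%g) (y1, y2)) eqXY.
by rewrite !cf_dfunl eqxx !mul1r.
Qed.

Lemma dcomul_grp (c : gT) : dcomul (grp k c) = grp k (c, c).
Proof.
apply: cfP => -[x1 x2] [y1 y2]; rewrite cf_comul !cfE xpair_eqE -natrM mulnb.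
by case: (y1 =P c) => [->|]; rewrite ?andbF ?andbT // eq_sym.
Qed.

Lemma dtens_grp (c : gT) : dtens (grp k c) = grp k (c, c).
Proof.
by apply: cfP => -[x1 x2] [y1 y2]; rewrite cf_dtens !cfE xpair_eqE -natrM mulnb.
Qed.

Definition invariant_twist F := forall c : gT, F * grp k (c, c) = grp k (c, c) * F.

Lemma invariant_twistP F :
  (forall c x1 x2 y1 y2, cf F (x1 ^ c, x2 ^ c)%g (y1 ^ c, y2 ^ c)%g =
                         cf F (x1, x2) (y1, y2)) <-> invariant_twist F.
Proof.
split=> [FJ c|FC c x1 x2 y1 y2].
  apply: cfP => -[x1 x2] [y1 y2]; rewrite cf_grpl cf_grpr.
  by rewrite -(FJ c) !pairJ /conjg !mulgA !mulgKV.
have := congr1 (fun F => cf F (x1, x2) (y1 * c, y2 * c)%g) (FC c).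
by rewrite cf_grpl cf_grpr !pairV !pairM !mulgK pairJ => ->; rewrite /conjg !mulgA.
Qed.

(** These are the elements of the subalgebra kG of D. *)
Definition constant a := forall x y, cf a x y = cf a 1%g y.

Lemma constantM a b : constant a -> constant b -> constant (a * b).
Proof.
move=> ca cb x y; rewrite !cfM; apply: eq_bigr => z _.
by rewrite ca cb [in RHS]cb.
Qed.

Lemma constant_grp (c : gT) : constant (grp k c).
Proof. by move=> x y; rewrite !cfE. Qed.

(** The constant element with the coefficients of b at x = 1 has the same product with a as b;
    cancel a. *)
Lemma constant_inv a b : constant a -> inverse_pair a b -> constant b.
Proof.
move=> ca [ab ba]; suff -> : b = mkD (fun _ y => cf b 1%g y).
  by move=> x y; rewrite !cfE.
rewrite -[RHS]mul1r -ba -mulrA -[LHS]mulr1; congr (_ * _).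
apply: cfP => x y; transitivity (cf (a * b) 1%g y); first by rewrite ab !cf1.
rewrite !cfM; apply: eq_bigr => z _.
by rewrite cfE ca conj1g.
Qed.

Lemma constant_comulC a F : constant a -> invariant_twist F ->
  F * dcomul a = dcomul a * F.
Proof.
move=> ca FC; apply: cfP => -[x1 x2] [y1 y2]; rewrite cf_comul_mul cf_mul_comul.
apply: eq_bigr => z _; rewrite ca [in RHS]ca mulrC; congr (_ * _).
have /invariant_twistP/(_ z) FJ := FC.
by rewrite -FJ /conjg !mulgA !mulgKV.
Qed.

(** The coefficients are pairwise orthogonal idempotents of k, so a nonzero one equals 1 and all the
    others vanish. *)
Lemma constant_grouplike a : constant a ->
    (forall s t, (s == t)%:R * cf a 1%g s = cf a 1%g s * cf a 1%g t) ->
  a != 0 -> exists c : gT, a = grp k c.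
Proof.
move=> ca gl nza; have [c nzc] : exists c, cf a 1%g c != 0.
  apply/existsP; apply: contraNT nza; rewrite negb_exists => /forallP a0.
  by apply/eqP/cfP => x y; rewrite ca cf0; apply/eqP; rewrite -[_ == _]negbK.
exists c; apply: cfP => x y; rewrite ca cfE; have := gl c y.
rewrite [y == c]eq_sym; case: (c =P y) => [<-|_].
  by rewrite mul1r -[LHS]mulr1 => /(mulfI nzc).
by rewrite mul0r => /esym/eqP; rewrite mulf_eq0 (negbTE nzc) => /eqP.
Qed.

End Gauge.

(** * Trivializing the twist in kG \otimes kG *)

Section UnitTwist.

Variables (k : fieldType) (gT : finGroupType).
Local Notation D1 := (drinfeld k gT).
Local Notation D2 := (drinfeld k (gT * gT)%type).
Variables (F F' : D2) (u : gT -> k).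
Hypothesis FV : inverse_pair F F'.
Hypothesis u1 : \sum_s u s = 1.
Hypothesis uE : forall s t,
  \sum_c cf F (1, 1)%g (s * c^-1, t * c^-1)%g * u c = u s * u t.
Let U : D1 := mkD (fun _ => u).

Lemma trivializer_E12 :
  F * dcomul U * (E1 k gT * E2 k gT) = dtens U * (E1 k gT * E2 k gT).
Proof.
apply/E12P => s t; rewrite cf_mul_comul cf_dtens !cfE -uE.
by apply: eq_bigr => c _; rewrite cfE.
Qed.

(* If U b = 0 then (U \otimes U)(b \otimes 1) = 0, hence Delta(U)(b \otimes 1)
   vanishes in kG \otimes kG since F is invertible; its coefficients are the
   products of those of U and of b. *)
Lemma trivializer_unit : exists U', inverse_pair U U'.
Proof.
apply: drinfeld_unit => b Ub; apply: cfP => x0 y0; rewrite cf0.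
(* The element of kG that collects the coefficients of b along the orbit of e_x0 y0 under left
   multiplication by the group. It inherits U w = 0, and its coefficient at y0 is the one to be
   killed. *)
pose w : D1 := mkD (fun _ z => cf b (x0 ^ (y0 * z^-1))%g z).
have Uw : U * w = 0.
  apply: cfP => x y; rewrite cf0 -[RHS](cf0 k (x0 ^ (y0 * y^-1))%g y) -Ub !cfM.
  apply: eq_bigr => z _; rewrite !cfE -conjgM; congr (_ * cf b (_ ^ _)%g _).
  by rewrite invMg invgK mulgA.
have [t nzt] : exists t, u t != 0.
  apply/existsP; apply: contraNT (oner_neq0 k); rewrite negb_exists -u1 => /forallP u0.
  by rewrite big1 // => t _; apply/eqP; rewrite -[_ == _]negbK.
pose E := E1 k gT * E2 k gT.
have EC X : E * X = X * E by apply: E12C.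
have Tw0 : dtens U * dinl w = 0.
  by rewrite dtensE -mulrA -dinlrC mulrA -dinlM Uw /dinl pull0 mul0r.
have DUw : dcomul U * dinl w * E = 0 * E.
  have : F' * (F * dcomul U * E * dinl w) = 0.
    by rewrite trivializer_E12 -[dtens U * _ * _]mulrA EC [dtens U * _]mulrA Tw0 mul0r mulr0.
  by rewrite mul0r -[_ * E * _]mulrA EC !mulrA FV.2 mul1r.
have /E12P/(_ (t * y0) t)%g := DUw.
rewrite cf0 cf_comul_mul (bigD1 t) //= big1 ?addr0 => [|z nz].
  rewrite /dinl (cf_pull _ (j := fun y => y.1)) => [|//].
  rewrite !cfE mulVg eqxx mul1r mulKg mulgV conjg1 => /eqP.
  by rewrite mulf_eq0 (negbTE nzt) => /eqP.
rewrite /dinl (cf_pull _ (j := fun y => y.1)) => [|//].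
rewrite xpair_eqE eqxx /=; case: eqP => [def_z|]; last by rewrite mul0r mulr0.
by case/eqP: nz; apply: (mulgI z^-1%g); rewrite -def_z mulVg.
Qed.

Lemma trivializer_gauge U' : inverse_pair U U' ->
  gauge U U' F * (E1 k gT * E2 k gT) = E1 k gT * E2 k gT.
Proof.
move=> UV; have UE := gaugeE F UV.
rewrite -[LHS]mul1r -(dtens1 k gT) -UV.2 dtensM -mulrA [dtens U * _]mulrA UE.
by rewrite trivializer_E12 mulrA -dtensM UV.2 dtens1 mul1r.
Qed.

Hypothesis FC : invariant_twist F.

(* Conjugation by U permutes the group-like elements of kG, since F is
   invariant and F Delta(U) = U \otimes U in the image kG \otimes kG. *)
Lemma trivializer_conj U' : inverse_pair U U' ->
  exists phi : gT -> gT, forall y, grp k (phi y) * U = U * grp k y.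
Proof.
move=> UV; apply: (fin_all_exists (P := fun y x => grp k x * U = U * grp k y)) => y.
have cU : constant U by move=> x z; rewrite !cfE.
have cU' : constant U' by apply: constant_inv UV.
pose z := U * grp k y * U'.
have cz : constant z by do 2?[apply: constantM => //]; apply: constant_grp.
have [E defE] : exists E, E = E1 k gT * E2 k gT by eexists.
have EC X : E * X = X * E by rewrite defE E12C.
have FDE : F * dcomul U * E = dtens U * E by rewrite defE trivializer_E12.
have DU' : dcomul U' * E = dtens U' * F * E.
  have : dtens U' * (F * dcomul U * E) * dcomul U' = dcomul U' * E.
    by rewrite FDE mulrA -dtensM UV.2 dtens1 mul1r EC.
  move=> <-; rewrite -[RHS]mulrA -[LHS]mulrA; congr (_ * _).
  by rewrite -[LHS]mulrA EC mulrA -[_ * dcomul U * _]mulrA -dcomulM UV.1 dcomul1 mulr1.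
(* In kG \otimes kG, Delta(z) F = F Delta(z) = F Delta(U) (y \otimes y) Delta(U') = (z \otimes z) F,
   and F is invertible. *)
have Dz : dcomul z * E = dtens z * E.
  have : dcomul z * F * E * F' = dtens z * F * E * F'.
    congr (_ * _); rewrite -constant_comulC // /z !dcomulM !dtensM.
    rewrite -[LHS]mulrA -[_ * dcomul U' * _]mulrA DU' dcomul_grp -dtens_grp.
    have moveE (X Y : D2) : F * (dcomul U * X * (Y * E)) = dtens U * X * Y * E.
      rewrite -!mulrA -[Y * E]EC [X * (E * Y)]mulrA -[X * E]EC -[E * X * Y]mulrA.
      by rewrite [RHS]mulrA -FDE -!mulrA.
    by rewrite moveE !mulrA.
  by rewrite -![_ * E * _]mulrA EC !mulrA -![_ * F * F']mulrA FV.1 !mulr1.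
have [s t||x def_z] := constant_grouplike cz.
- by have := Dz; rewrite defE => /E12P/(_ s t); rewrite cf_comul cf_dtens mulg1.
- apply: contra_neq (oner_neq0 D1) => z0.
  rewrite -UV.2 -[U]mulr1 -(grpV k y).1 !mulrA.
  have -> : U' * U * grp k y = U' * z * U by rewrite /z -!mulrA UV.2 mulr1.
  by rewrite z0 mulr0 !mul0r.
by exists x; rewrite -def_z /z -mulrA UV.2 mulr1.
Qed.

End UnitTwist.

(** * Trivializing the twist in D \otimes kG *)

Section CoinvariantTrivialization.

Variables (k : fieldType) (gT : finGroupType).
Local Notation D1 := (drinfeld k gT).
Local Notation D2 := (drinfeld k (gT * gT)%type).
Variables (F F' : D2).
Hypothesis FV : inverse_pair F F'.
Hypothesis Fcoc : dcocycle F.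
Hypothesis FC : invariant_twist F.
Hypothesis F11 : F * (E1 k gT * E2 k gT) = E1 k gT * E2 k gT.

Lemma cf_twist11 s t : cf F (1, 1)%g (s, t) = ((s == 1) && (t == 1))%g%:R.
Proof.
have := F11; rewrite -[RHS]mul1r => /E12P ->.
by rewrite cf1 xpair_eqE.
Qed.

(* The conjugation invariance of F is needed to reach every g, and not only
   some conjugate of g. *)
Lemma coinvariant_support (g : gT) : exists b,
  (g = 1%g -> b = 1%g) /\
  exists x y, (x ^ y)%g = g /\ cf F (x, 1)%g (y * b, b)%g != 0.
Proof.
have [->|ng1] := eqVneq g 1%g.
  exists 1%g; split=> //; exists 1%g, 1%g; rewrite conj1g mulg1; split=> //.
  by rewrite cf_twist11 eqxx oner_neq0.
(* Otherwise the coefficient of F' F = 1 at (g, 1), (1, 1) would vanish. *)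
have [[z1 z2] nz] : exists z : gT * gT,
    cf F (g ^ z.1, 1)%g (z.1^-1, z.2^-1)%g != 0.
  apply/existsP; apply: contraNT (oner_neq0 k); rewrite negb_exists => /forallP F0.
  have <- : cf (F' * F) (g, 1)%g 1%g = 1 by rewrite FV.2 cf1 eqxx.
  rewrite cfM big1 // => -[z1 z2] _.
  rewrite pairJ pairV pair1 pairM conj1g !mulg1.
  by have := F0 (z1, z2); rewrite negbK => /eqP ->; rewrite mulr0.
exists z2^-1%g; split=> [/eqP|]; first by rewrite (negbTE ng1).
exists (g ^ (z1 * z2^-1))%g, (z2 * z1^-1)%g; split.
  by rewrite -conjgM mulgA mulgKV mulgV conjg1.
have /invariant_twistP/(_ z2^-1%g) FJ := FC.
move: nz; rewrite /= -FJ conj1g -conjgM.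
by rewrite [(z2^-1 ^ _)%g]conjgE invgK mulKVg [(_^-1 ^ z2^-1)%g]conjgE invgK mulgA.
Qed.

(** For fixed b, the cocycle equation at (x, 1, 1), (y b, c b, b) says that the coefficients F (x,
    1) (y b, b) solve the linear equation for v. That equation only relates pairs (x, y) with the
    same x^y, so b may be chosen separately for each value of x^y; [beta] makes that choice so that
    v is invertible. *)
Lemma coinvariant_trivialization : exists v v' : D1,
  [/\ inverse_pair v v', F * dcomul v * E2 k gT = dinl v * E2 k gT
    & forall y, cf v 1%g y = (y == 1%g)%:R].
Proof.
have [beta betaP] := fin_all_exists coinvariant_support.
have beta1 : beta 1%g = 1%g by have [->] := betaP 1%g.
pose v : D1 := mkD (fun x y => let b := beta (x ^ y)%g in cf F (x, 1)%g (y * b, b)%g).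
have Fv : F * dcomul v * E2 k gT = dinl v * E2 k gT.
  apply/E2P => x y c; rewrite cf_mul_comul cf_inl; pose b := beta (x ^ y)%g.
  (* This side collapses to one term because F is trivial in kG \otimes kG; the other side is the
     coefficient of F Delta(v). *)
  have rhs : cf (din23 F * dcomul23 F) (x, 1, 1)%g (y * b, c * b, b)%g =
      (c == 1%g)%:R * cf v x y.
    rewrite cf_cocycler (bigD1 1%g) //= [X in _ + X]big1 ?addr0; last first.
      by move=> z nz; rewrite big1 // => t _; rewrite cf_twist11 (negbTE nz) mul0r.
    rewrite (bigD1 1%g) //= [X in _ + X]big1 ?addr0; last first.
      by move=> z nz; rewrite cf_twist11 (negbTE nz) andbF mul0r.
    rewrite cf_twist11 !eqxx mul1r !invg1 !mul1g !conj1g mulg1 cfE /= -/b.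
    rewrite -[X in _ == X]mul1g (inj_eq (mulIg b)).
    by case: eqP => [->|]; rewrite ?mul0r // mul1g.
  have h_inj : injective (fun z : gT => y * z^-1)%g.
    by move=> z t /mulgI/invg_inj.
  rewrite -rhs -Fcoc cf_cocyclel [RHS](reindex_inj h_inj).
  apply: eq_bigr => z _ /=; rewrite (bigD1 (c * z^-1)%g) //= [X in _ + X]big1 ?addr0.
    rewrite !conj1g !mulg1 cfE /= -conjgM mulgKV -/b.
    by rewrite !invMg !invgK !mulgA !mulgKV eqxx mul1r.
  move=> t nt; case: eqP => [def_t|]; last by rewrite mul0r mulr0.
  case/eqP: nt; move: def_t; rewrite invMg invgK !mulgA mulgKV => def_t.
  by apply: invg_inj; apply: (mulIg c); apply: (mulIg b); rewrite -def_t invMg invgK mulgKV.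
have v1 y : cf v 1%g y = (y == 1%g)%:R.
  by rewrite cfE /= conj1g beta1 mulg1 cf_twist11 eqxx andbT.
have [z vz|v' vV] := @drinfeld_unit _ _ v; last by exists v, v'.
(* If v z = 0, then Delta(v)(z \otimes 1) vanishes in D \otimes kG. Its coefficient at (x, 1), (c y,
   c) is the product of those of v at (x, c) and of z at (x^c, y), and [betaP] provides a nonzero
   one of v for each x^c = g. *)
have Dvz : dcomul v * dinl z * E2 k gT = 0 * E2 k gT.
  have : F' * (F * dcomul v * E2 k gT * dinl z) = 0.
    rewrite Fv -[_ * _ * dinl z]mulrA E2C [dinl v * _]mulrA -dinlM vz /dinl.
    by rewrite pull0 mul0r mulr0.
  by rewrite mul0r -[_ * E2 k gT * _]mulrA E2C !mulrA FV.2 mul1r.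
apply: cfP => g y; rewrite cf0.
have [_ [x [c [def_g nz]]]] := betaP g.
have /E2P/(_ x (c * y)%g c) := Dvz.
rewrite cf0 cf_comul_mul (bigD1 c) //= big1 ?addr0 => [|t nt]; rewrite cf_inl.
  rewrite mulVg eqxx mul1r mulKg def_g mulg1 cfE /= def_g => /eqP.
  by rewrite mulf_eq0 (negbTE nz) => /eqP.
case: eqP => [def_t|]; last by rewrite mul0r mulr0.
by case/eqP: nt; apply: (mulgI t^-1%g); rewrite def_t mulVg.
Qed.

End CoinvariantTrivialization.

(** * Reduction to a function on pairs, and the role of the R-matrix *)

Section DiagonalTwist.

Variables (k : fieldType) (gT : finGroupType).
Local Notation D1 := (drinfeld k gT).
Local Notation D2 := (drinfeld k (gT * gT)%type).
Local Notation E1 := (E1 k gT).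
Local Notation E2 := (E2 k gT).
Local Notation R := (Rmx k gT).
Implicit Types (w : D1) (F X : D2).

(** The cocycle equation at (x1, x2, 1) confines the support of F to y2 = 1, and at (x1, 1, x2) to
    y1 = y2: at such points one factor F on each side is trivial. *)
Lemma normalized_twist_diag F : dcocycle F -> F * E1 = E1 -> F * E2 = E2 ->
  F = dfun (fun x => cf F x 1%g).
Proof.
move=> Fcoc FE1 FE2.
have cfF1 x y1 y2 : cf F (1%g, x) (y1, y2) = ((y1 == 1) && (y2 == 1))%g%:R.
  by have := FE1; rewrite -[RHS]mul1r => /E1P ->; rewrite cf1 xpair_eqE.
have cfF2 x y1 y2 : cf F (x, 1%g) (y1, y2) = ((y1 == 1) && (y2 == 1))%g%:R.
  by have := FE2; rewrite -[RHS]mul1r => /E2P ->; rewrite cf1 xpair_eqE.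
have F_r x1 x2 y1 y2 : cf F (x1, x2) (y1, y2) = (y2 == 1%g)%:R * cf F (x1, x2) (y1, y2).
  have := congr1 (fun Z => cf Z (x1, x2, 1)%g (y1, y2, 1)%g) Fcoc.
  rewrite cf_cocyclel cf_cocycler (sum_pair1 (a := y1) (b := y2)) => [|z t]; last first.
    rewrite xpair_eqE cfF2 eqxx andbT => nzt.
    case: eqP => [eq_zt|]; last by rewrite mul0r mulr0.
    case: eqP => [def_z|]; last by rewrite !mulr0.
    case/negP: nzt; rewrite -(inj_eq (mulgI z^-1%g) z) -(inj_eq (mulgI t^-1%g) t).
    by rewrite -eq_zt def_z !mulVg eqxx.
  rewrite (sum_pair1 (a := 1%g) (b := 1%g)) => [|z t]; last first.
    by rewrite cfF2 xpair_eqE => /negbTE->; rewrite mul0r.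
  by rewrite !cfF2 !mulVg !invg1 !mul1g conj1g conjg1 mulg1 !eqxx !mul1r mulr1.
have F_l x1 x2 y1 y2 : cf F (x1, x2) (y1, y2) = (y1 == y2)%:R * cf F (x1, x2) (y1, y2).
  have := congr1 (fun Z => cf Z (x1, 1, x2)%g (y1, y2, y2)%g) Fcoc.
  rewrite cf_cocyclel cf_cocycler (sum_pair1 (a := 1%g) (b := 1%g)) => [|z t]; last first.
    by rewrite cfF2 xpair_eqE => /negbTE->; rewrite mul0r.
  rewrite (sum_pair1 (a := 1%g) (b := 1%g)) => [|z t]; last first.
    by rewrite cfF1 xpair_eqE => /negbTE->; rewrite mul0r.
  rewrite cfF1 cfF2 !invg1 !mul1g conj1g !conjg1 mulg1 mul1g !eqxx !mul1r.
  by case: eqP => [->|]; rewrite ?mul0r ?mul1r // => ->.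
apply: cfP => -[x1 x2] [y1 y2]; rewrite cfE xpair_eqE F_l F_r.
case: (y2 =P 1%g) => [->|]; last by rewrite andbF mul0r !mulr0.
by case: eqP => [->|]; rewrite ?mul0r ?mulr0 ?mul1r ?mulr1.
Qed.

Lemma dswap_tens w : dswap (dtens w) = dtens w.
Proof. by apply: cfP => -[x1 x2] [y1 y2]; rewrite cf_swap !cfE mulrC. Qed.

Lemma dswapE1 : dswap E1 = E2.
Proof. by apply: cfP => -[x1 x2] [y1 y2]; rewrite cf_swap !cfE !xpair_eqE andbC. Qed.

Lemma dswapE2 : dswap E2 = E1.
Proof. by apply: cfP => -[x1 x2] [y1 y2]; rewrite cf_swap !cfE !xpair_eqE andbC. Qed.

(** Quasi-cocommutativity of the double; both sides are supported on y2 = x1 y1. *)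
Lemma Rmx_comul w : R * dcomul w = dswap (dcomul w) * R.
Proof.
apply: cfP => -[x1 x2] [y1 y2]; rewrite cf_Rl cf_Rr cf_swap !cf_comul.
have -> : (y1 == x1^-1 * y2)%g = (y2 == x1 * y1)%g.
  by rewrite -(inj_eq (mulgI x1)) mulKVg eq_sym.
have -> : (y2 * x1^-1 ^ y1 == y1)%g = (y2 == x1 * y1)%g.
  by rewrite -(inj_eq (mulIg (x1 ^ y1)%g)) conjVg mulgKV -conjgC.
case: eqP => [->|]; last by rewrite !mul0r.
by rewrite -conjgC [(x1 * y1)%g]conjgC conjVg mulgK.
Qed.

Lemma Rmx_E1 : R * E1 = E1.
Proof.
rewrite -[RHS]mul1r; apply/E1P => x y1 y2.
by rewrite cf1 cfE xpair_eqE.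
Qed.

Variables (F F' : D2) (w w' : D1).
Hypothesis FR : R * F = dswap F * R.
Hypothesis wV : inverse_pair w w'.
Let F2 := gauge w w' F.
Hypothesis F2E2 : F2 * E2 = E2.

Lemma gauge_Rmx : R * dtens w * F2 = dtens w * dswap F2 * R.
Proof.
rewrite -mulrA gaugeE // mulrA FR -[LHS]mulrA Rmx_comul [LHS]mulrA -dswapM.
by rewrite -(gaugeE F wV) dswapM dswap_tens.
Qed.

Lemma dtensK X Y : dtens w * X = dtens w * Y -> X = Y.
Proof.
move/(congr1 (fun X => dtens w' * X)).
by rewrite !mulrA -dtensM wV.2 dtens1 !mul1r.
Qed.

(** In kG \otimes D the matrix R is trivial, so [gauge_Rmx] identifies F2 there with its flip, which
    is trivial by [F2E2]. *)
Lemma gauge_E1 : F2 * E1 = E1.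
Proof.
apply: dtensK.
have <- : R * dtens w * F2 * E1 = dtens w * E1.
  rewrite gauge_Rmx -[LHS]mulrA Rmx_E1 -[LHS]mulrA; congr (_ * _).
  by rewrite -{1}dswapE2 -dswapM F2E2 dswapE2.
rewrite -[RHS]mulrA -[F2 * E1]E1C [RHS]mulrA -[R * _ * E1]mulrA -[dtens w * E1]E1C.
by rewrite [R * _]mulrA Rmx_E1 [E1 * dtens w]E1C mulrA.
Qed.

(** In D \otimes kG both F2 and its flip are now trivial, and they drop out of [gauge_Rmx]. *)
Lemma gauge_RmxE2 : R * dtens w * E2 = dtens w * R * E2.
Proof.
have <- : R * dtens w * F2 * E2 = R * dtens w * E2 by rewrite -[LHS]mulrA F2E2.
have sF2 : dswap F2 * E2 = E2 by rewrite -{1}dswapE1 -dswapM gauge_E1 dswapE1.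
rewrite gauge_Rmx -[LHS]mulrA -[R * E2]E2C [LHS]mulrA -[_ * _ * E2]mulrA sF2.
by rewrite -[LHS]mulrA E2C mulrA.
Qed.

(** With u the image of w in kG, this says x u = u x^y: conjugation by u determines the support of
    w. *)
Lemma gauge_conj x y : cf w x y != 0 -> forall t,
  cf w 1%g (x^-1 * t)%g = cf w 1%g (t * (x ^ y)^-1)%g.
Proof.
move=> nzw t; have /E2P/(_ x y t) := gauge_RmxE2.
by rewrite cf_Rl cf_Rr conj1g !cf_dtens conjVg => /(mulfI nzw).
Qed.

End DiagonalTwist.

(** * Trace forms attached to commuting pairs *)

Section CommutingPairTrace.

Variables (k : fieldType) (gT : finGroupType).
Local Notation D1 := (drinfeld k gT).
Implicit Types (a b : D1).

(* For commuting h and y this is a trace form; it separates the conjugacy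
   classes of commuting pairs. *)
Definition ptrace (h y : gT) a : k := \sum_s cf a (h ^ s)%g (y ^ s)%g.

Lemma ptraceC h y a b : commute h y -> ptrace h y (a * b) = ptrace h y (b * a).
Proof.
move=> hyC; rewrite /ptrace.
under eq_bigr do rewrite cfM.
under [RHS]eq_bigr do rewrite cfM.
rewrite !pair_bigA /=.
(* This substitution exchanges the two factors of y^s = z (z^-1 y^s) while moving the base point
   from s to s z. It is injective because the product of the two components is y s. *)
pose g (p : gT * gT) : gT * gT := (p.1 * p.2, p.2^-1 * y ^ p.1)%g.
have hJy : (h ^ y = h)%g by rewrite conjgE hyC mulKg.
have gM s z : (s * z * (z^-1 * y ^ s) = y * s)%g by rewrite -mulgA mulKVg -conjgC.
have g_inj : injective g.
  move=> [s1 z1] [s2 z2] [eq1 eq2]; have := gM s1 z1.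
  rewrite eq1 eq2 gM => /mulgI eqs.
  by move: eq1; rewrite -eqs => /mulgI ->.
rewrite [RHS](reindex_inj g_inj); apply: eq_bigr => -[s z] _ /=.
rewrite mulrC -conjgM; congr (_ * _).
rewrite -conjgM gM conjgM hJy; congr (cf _ _ _).
by rewrite invMg invgK conjgM -mulgA -conjgC mulKg.
Qed.

End CommutingPairTrace.

(** * Making the gauge element equivariant *)

Section Equivariance.

Variables (k : fieldType) (gT : finGroupType).
Hypothesis char0 : [pchar k] =i pred0.
Local Notation D1 := (drinfeld k gT).
Local Notation D2 := (drinfeld k (gT * gT)%type).
Local Notation E2 := (E2 k gT).
Local Notation e1 := (e1 k gT).
Local Notation grp := (@grp k gT).
Variables (F : D2) (w w' U U' : D1) (phi : gT -> gT).
Hypothesis FC : invariant_twist F.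
Hypothesis wV : inverse_pair w w'.
Hypothesis UV : inverse_pair U U'.
Hypothesis phiU : forall y, grp (phi y) * U = U * grp y.
Hypothesis w_e1 : w * e1 = U * e1.
Hypothesis FwE2 : F * dcomul w * E2 = dtens w * E2.
Hypothesis w_supp : forall x y, cf w x y != 0 -> x = phi (x ^ y)%g.

Lemma grp_inj : injective grp.
Proof.
move=> a b /(congr1 (fun z => cf z 1%g a)); rewrite !cfE eqxx.
by case: eqP => // _ /eqP; rewrite oner_eq0.
Qed.

Lemma phiM : {morph phi : y z / (y * z)%g}.
Proof.
move=> y z; apply: grp_inj; rewrite -[LHS]mulr1 -[RHS]mulr1 -UV.1 !mulrA phiU.
by rewrite -!grpM -[grp (phi y) * _ * U]mulrA phiU !mulrA phiU.
Qed.

Lemma phi_inj : injective phi.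
Proof.
move=> y z eq_phi; apply: grp_inj; rewrite -[LHS]mul1r -[RHS]mul1r -UV.2.
by rewrite -!mulrA -!phiU eq_phi.
Qed.

Lemma w_idem g : w * idem k g = idem k (phi g) * w.
Proof.
apply: cfP => x y; rewrite !idemE cf_dfunl cf_dfunr mulrC.
have [->|/w_supp def_x] := eqVneq (cf w x y) 0; first by rewrite !mulr0.
by rewrite {3}def_x (inj_eq phi_inj).
Qed.

Lemma w'_e1 : w' * e1 = U' * e1.
Proof.
have -> : w' * e1 = w' * (U * e1) * U' by rewrite -!mulrA e1C [U * _]mulrA UV.1 mul1r.
by rewrite -w_e1 mulrA wV.2 mul1r e1C.
Qed.

(** It is 1 exactly when w y = phi(y) w. *)
Definition defect y : D1 := locked (w' * grp (phi y)^-1%g * w * grp y).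

Lemma defectE y : w * defect y = grp (phi y)^-1%g * w * grp y.
Proof. by rewrite /defect -lock !mulrA wV.1 mul1r. Qed.

Lemma defect_e1 y : defect y * e1 = e1.
Proof.
rewrite /defect -lock -!mulrA -[grp y * e1]e1C [w * (e1 * _)]mulrA w_e1 -[U * e1]e1C.
rewrite -[e1 * U * _]mulrA -phiU [grp _ * (e1 * _)]mulrA -[grp _ * e1]e1C.
rewrite -[e1 * _ * _]mulrA [grp _ * (grp _ * _)]mulrA (grpV k (phi y)).2 mul1r.
by rewrite mulrA w'_e1 -mulrA e1C mulrA UV.2 mul1r.
Qed.

(** By invariance of F, both w and phi(y)^-1 w y trivialize F in D \otimes kG, so their quotient d
    satisfies Delta(d) = d \otimes d there. The image of d in kG is 1, hence Delta(d) = d \otimes 1,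
    which leaves no coefficient off the unit of the group. *)
Lemma defect_diag y : defect y = dfun (fun x => cf (defect y) x 1%g).
Proof.
have defect1 t : cf (defect y) 1%g t = (t == 1%g)%:R.
  by have := defect_e1 y; rewrite -[RHS]mul1r => /e1P ->; rewrite cf1.
pose d := defect y; pose wy := grp (phi y)^-1%g * w * grp y.
have wyE : F * dcomul wy * E2 = dtens wy * E2.
  rewrite /wy !dcomulM !dtensM !dcomul_grp !dtens_grp.
  rewrite !mulrA FC; set A := (X in X * F * _ * _ * _ = _); set B := (X in _ * X * E2 = _).
  have moveB (X : D2) : A * X * B * E2 = A * (X * E2) * B.
    by rewrite -[LHS]mulrA -[B * E2]E2C !mulrA.
  by rewrite -[A * F * _]mulrA !moveB FwE2.
have dE : dcomul d * E2 = dtens d * E2.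
  have : F * dcomul w * E2 * dcomul d = dtens w * dtens d * E2.
    by rewrite -dtensM defectE -/wy -wyE /wy -defectE dcomulM -!mulrA E2C.
  rewrite FwE2 -!mulrA E2C => /(congr1 (fun X => dtens w' * X)).
  by rewrite !mulrA -dtensM wV.2 dtens1 !mul1r.
apply: cfP => x t; rewrite [RHS]cfE; have /E2P/(_ x t t) := dE.
rewrite cf_comul cf_dtens eqxx mul1r mulg1 defect1 => def_d.
by move: def_d; case: eqP => [->|_]; rewrite ?mulr0 ?mulr1.
Qed.

Local Notation delta y h := (cf (defect y) h 1%g).

(* The defects form a 1-cocycle of gT with values in the invertible functions
   on gT; by Shapiro's lemma it is a coboundary as soon as the characters
   y |-> delta y h of the centralisers of the h are trivial. *)
Lemma defectM y z h : delta (y * z)%g h = delta z h * delta y (h ^ z^-1)%g.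
Proof.
have -> : defect (y * z)%g = defect z * (grp z^-1%g * defect y * grp z).
  rewrite -[LHS]mul1r -wV.2 -[LHS]mulrA defectE phiM invMg -!grpM.
  rewrite -[RHS]mul1r -wV.2 -[RHS]mulrA [w * (defect z * _)]mulrA defectE.
  congr (_ * _); rewrite !mulrA -[_ * grp z * grp z^-1%g]mulrA (grpV k z).1 mulr1.
  by rewrite -[_ * w * defect y]mulrA defectE !mulrA.
rewrite [defect z]defect_diag cf_dfunl; congr (_ * _); first by rewrite cfE eqxx mulr1.
by rewrite cf_grpr cf_grpl invgK mul1g mulgV.
Qed.

(** Conjugation by w turns y e_h into d phi(y) e_phi(h). Taking [ptrace], the number of s that fix
    the pair (h, y) is d times the number of those that carry it to (phi h, phi y). The first is
    nonzero in characteristic 0, so the two pairs are conjugate, the two numbers agree, and d =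
    1. *)
Lemma defect_commute h y : commute h y -> delta y h = 1.
Proof.
move=> hyC; set d := delta y h.
have hJy : (h ^ y = h)%g by rewrite conjgE hyC mulKg.
have conj_w : w * (grp y * idem k h) * w' =
    dfun (fun _ => d) * (grp (phi y) * idem k (phi h)).
  have def_wy : w * grp y = grp (phi y) * w * defect y.
    by rewrite -[RHS]mulrA defectE !mulrA (grpV k (phi y)).1 mul1r.
  set C := dfun _.
  have CC (a : D1) : C * a = a * C by apply: dfun_central.
  have dI : defect y * idem k h = idem k h * C.
    rewrite defect_diag idemE !dfunM; apply: cfP => x t; rewrite !cfE.
    by case: (x =P h) => [->|]; rewrite ?mulr0 ?mul0r // mul1r mulr1.
  have wdI : w * (defect y * idem k h) = C * idem k (phi h) * w.
    by rewrite dI mulrA w_idem -CC mulrA.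
  have -> : w * (grp y * idem k h) * w' = grp (phi y) * (w * (defect y * idem k h)) * w'.
    by rewrite [w * (grp y * _)]mulrA def_wy !mulrA.
  by rewrite wdI -!mulrA wV.1 mulr1 mulrA -CC -mulrA.
pose P a b := [pred s | ((h ^ s == b) && (y ^ s == a))%g].
have card_sum (Q : pred gT) : \sum_s (Q s)%:R = #|Q|%:R :> k.
  rewrite -sum1_card natr_sum [RHS]big_mkcond; apply: eq_bigr => s _.
  by rewrite unfold_in; case: (Q s).
have trP a b : ptrace h y (grp a * idem k b) = #|P a b|%:R.
  rewrite -card_sum; apply: eq_bigr => s _.
  rewrite idemE cf_dfunr cfE -natrM mulnb; congr (nat_of_bool _)%:R.
  by rewrite /= -conjgM -conjgC conjgM hJy andbC.
have eqN : #|P y h|%:R = d * #|P (phi y) (phi h)|%:R :> k.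
  rewrite -!trP; transitivity (ptrace h y (w * (grp y * idem k h) * w')).
    by rewrite [RHS]ptraceC // [w' * _]mulrA wV.2 mul1r.
  rewrite conj_w /ptrace mulr_sumr; apply: eq_bigr => s _.
  by rewrite cf_dfunl.
have nzN : #|P y h|%:R != 0 :> k.
  rewrite ((pcharf0P k).1 char0) -lt0n; apply/card_gt0P; exists 1%g.
  by rewrite unfold_in /= !conjg1 !eqxx.
have [s0 /andP[/eqP hs0 /eqP ys0]] : exists s0, s0 \in P (phi y) (phi h).
  apply/card_gt0P; rewrite lt0n; apply: contraNneq nzN => N0.
  by rewrite eqN N0 mulr0.
(* Right translation by [s0] matches the two sets. *)
have eqNN : #|P (phi y) (phi h)|%:R = #|P y h|%:R :> k.
  rewrite -!card_sum (reindex_inj (mulIg s0)); apply: eq_bigr => s _ /=.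
  by rewrite -hs0 -ys0 !conjgM !(inj_eq (conjg_inj s0)).
by apply: (mulIf nzN); rewrite mul1r -eqNN -eqN eqNN.
Qed.

(** The coboundary is explicit: f h is the value of the cocycle along an element [t h] that
    conjugates the chosen representative [r h] of the class to h. *)
Lemma equivariant_rescaling : exists f : gT -> k,
  [/\ forall h, f h != 0, f 1%g = 1
    & forall y, grp (phi y) * (w * dfun f) = w * dfun f * grp y].
Proof.
pose r (h : gT) := repr (h ^: [set: gT])%g.
have rJ h y : r (h ^ y)%g = r h.
  by rewrite /r classGidl ?inE.
have rP h : exists y, (r h ^ y = h)%g.
  have /imsetP[y _ def_r] : r h \in (h ^: [set: gT])%g.
    by apply: (mem_repr h); apply: class_refl.
  by exists y^-1%g; rewrite def_r conjgK.
have [t tP] := fin_all_exists rP.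
have d1 h : delta 1%g h = 1 by apply: defect_commute; apply: commute1.
pose f h := delta (t h) h; exists f; split=> [h||y].
- have := defectM (t h)^-1%g (t h) h; rewrite mulVg d1 -/(f h) => /eqP.
  by apply: contraTneq => ->; rewrite mul0r oner_eq0.
- by apply: defect_commute; apply/commute_sym/commute1.
(* The two ways from the representative to h differ by c, which centralises the representative and
   so contributes 1 by [defect_commute]. *)
have def_f h : delta y h * f (h ^ y^-1)%g = f h.
  set h' := (h ^ y^-1)%g; pose c := (t h' * y * (t h)^-1)%g.
  rewrite /f -defectM; have -> : (t h' * y = c * t h)%g by rewrite mulgKV.
  have htr : (h ^ (t h)^-1 = r h)%g by rewrite -{1}(tP h) conjgK.
  rewrite defectM htr (@defect_commute (r h) c) ?mulr1 //.
  apply/commgP/conjg_fixP; rewrite /c conjgM conjgM.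
  have <- : r h' = r h by apply: rJ.
  by rewrite tP /h' conjgKV htr /h' rJ.
have {1}-> : dfun f = defect y * (grp y^-1%g * (dfun f * grp y)).
  rewrite defect_diag; apply: cfP => x z; rewrite cf_dfunl cf_grpl !cf_grpr !cfE.
  rewrite mulrA def_f invgK; congr (_ * (nat_of_bool _)%:R).
  by rewrite -(conjg_eq1l z y^-1) conjgE invgK mulgA.
rewrite [w * (defect y * _)]mulrA defectE !mulrA (grpV k (phi y)).1 mul1r.
by rewrite -[_ * grp y * grp y^-1%g]mulrA (grpV k y).1 mulr1.
Qed.

End Equivariance.

(** The element c \otimes c crosses Delta(w) as phi(c) \otimes phi(c), commutes with F in this form,
    and turns back into c \otimes c across w' \otimes w'. *)
Lemma gauge_invariant (k : fieldType) (gT : finGroupType) (w w' : drinfeld k gT)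
    (F : drinfeld k (gT * gT)%type) (phi : gT -> gT) :
  inverse_pair w w' -> (forall y, grp k (phi y) * w = w * grp k y) ->
  invariant_twist F -> invariant_twist (gauge w w' F).
Proof.
move=> [ww' w'w] wJ FC c; rewrite /gauge -dtensE -dcomul_grp -[LHS]mulrA -dcomulM.
have w'J : w' * grp k (phi c) = grp k c * w'.
  by rewrite -[LHS]mulr1 -ww' mulrA -[w' * _ * w]mulrA wJ !mulrA w'w mul1r.
rewrite -wJ dcomulM dcomul_grp mulrA -[dtens w' * _ * _]mulrA FC mulrA.
by rewrite -dtens_grp -dtensM w'J dtensM dtens_grp -dcomul_grp !mulrA.
Qed.

(** * Gauging the twist to an invariant function *)

Section Diagonalization.

Variables (k : closedFieldType) (gT : finGroupType).
Hypothesis char0 : [pchar k] =i pred0.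
Local Notation D1 := (drinfeld k gT).
Local Notation D2 := (drinfeld k (gT * gT)%type).
Local Notation E1 := (E1 k gT).
Local Notation E2 := (E2 k gT).
Variables (F F' : D2).
Hypothesis FV : inverse_pair F F'.
Hypothesis Fcoc : dcocycle F.
Hypothesis FC : invariant_twist F.
Hypothesis FR : Rmx k gT * F = dswap F * Rmx k gT.
Hypothesis F1 : forall t, \sum_s cf F (1, 1)%g (s, t) = (t == 1%g)%:R.

(** R is trivial in kG \otimes kG, so [FR] makes the image of F there symmetric. *)
Lemma cf11_trivial : exists2 u : gT -> k, \sum_s u s = 1 & forall s t,
  \sum_c cf F (1, 1)%g (s * c^-1, t * c^-1)%g * u c = u s * u t.
Proof.
apply: (symmetric_twist_trivial (J := fun s t => cf F (1, 1)%g (s, t))) => //.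
  move=> s t; have := congr1 (fun X => cf X (1, 1)%g (s, t)) FR.
  by rewrite cf_Rl cf_Rr cf_swap conj1g invg1 conj1g mul1g mulg1.
move=> s t r; have := congr1 (fun X => cf X (1, 1, 1)%g (s, t, r)) Fcoc.
have rhs_sum (a b c : gT) (h : gT -> k) :
    \sum_z1 \sum_z2 cf F (1, 1)%g (z1, z2) * ((z1^-1 * a == z2^-1 * b)%g%:R * h (z1^-1 * a)%g)
  = \sum_c cf F (1, 1)%g (a * c^-1, b * c^-1)%g * h c.
  have h_inj : injective (fun z : gT => a * z^-1)%g by move=> z z' /mulgI/invg_inj.
  rewrite (reindex_inj h_inj) /=; apply: eq_bigr => z _.
  rewrite (bigD1 (b * z^-1)%g) //= big1 ?addr0 => [|z2 nz].
    by rewrite !invMg !invgK !mulgKV eqxx mul1r.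
  rewrite invMg invgK mulgKV; case: eqP => [def_z|]; last by rewrite mul0r mulr0.
  by case/eqP: nz; rewrite def_z invMg invgK mulKVg.
rewrite cf_cocyclel cf_cocycler.
under eq_bigr do under eq_bigr do rewrite !conj1g mulg1.
under [RHS]eq_bigr do under eq_bigr do rewrite !conj1g mulg1.
by rewrite (rhs_sum s t r (fun c => cf F (1, 1)%g (c, r)))
           (rhs_sum t r s (fun c => cf F (1, 1)%g (s, c))).
Qed.

Lemma dtens_dfun (f : gT -> k) : dtens (dfun f) = dfun (fun x => f x.1 * f x.2).
Proof.
apply: cfP => -[x1 x2] [y1 y2]; rewrite cf_dtens !cfE xpair_eqE mulrACA.
by rewrite -natrM mulnb.
Qed.

Lemma dcomul_dfun (f : gT -> k) : dcomul (dfun f) = dfun (fun x => f (x.1 * x.2)%g).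
Proof.
apply: cfP => -[x1 x2] [y1 y2]; rewrite cf_comul !cfE xpair_eqE mulrCA.
rewrite -natrM mulnb; congr (_ * (nat_of_bool _)%:R).
by rewrite andbC; case: eqP => [->|//]; rewrite eq_sym.
Qed.

Lemma twist_diagonalizable : exists w w' b,
  [/\ inverse_pair w w', gauge w w' F = dfun b, \sum_y cf w 1%g y = 1,
      invariant_twist (dfun b : D2) & forall x, b (1, x)%g = 1 /\ b (x, 1)%g = 1].
Proof.
have [u u1 uE] := cf11_trivial.
have [U' UV] := trivializer_unit FV u1 uE.
have [phi phiU] := trivializer_conj FV uE FC UV.
set U := mkD _ in UV phiU.
pose G := gauge U U' F; pose G' := dcomul U' * F' * dtens U.
have GV : inverse_pair G G' by apply: gauge_inv.
have Gcoc : dcocycle G by apply: gauge_cocycle UV.1 Fcoc.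
have GC : invariant_twist G by apply: gauge_invariant UV phiU FC.
have G11 : G * (E1 * E2) = E1 * E2 by apply: trivializer_gauge.
have [v [v' [vV Gv v1]]] := coinvariant_trivialization GV Gcoc GC G11.
pose w := U * v; pose w' := v' * U'.
have wV : inverse_pair w w'.
  split; rewrite /w /w' mulrA.
    by rewrite -[U * v * v']mulrA vV.1 mulr1 UV.1.
  by rewrite -[v' * U' * U]mulrA UV.2 mulr1 vV.2.
have v_e1 : v * e1 k gT = e1 k gT.
  by rewrite -[RHS]mul1r; apply/e1P => y; rewrite v1 cf1.
have F2E : gauge w w' F = gauge v v' G by rewrite gauge_comp.
have F2E2 : gauge w w' F * E2 = E2.
  apply: (dtensK vV); rewrite mulrA F2E gaugeE // Gv; apply/E2P => x y c.
  by rewrite cf_inl cf_dtens v1 mulrC.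
have F2E1 : gauge w w' F * E1 = E1 by apply: gauge_E1.
have F2coc : dcocycle (gauge w w' F) by apply: gauge_cocycle wV.1 Fcoc.
have := normalized_twist_diag F2coc F2E1 F2E2.
set b := (fun x => cf (gauge w w' F) x 1%g) => F2b.
have w_e1 : w * e1 k gT = U * e1 k gT by rewrite -mulrA v_e1.
have cf_w1 y : cf w 1%g y = u y by have /e1P-> := w_e1; rewrite cfE.
(* By [gauge_conj], x U = U x^y, and the right side is phi(x^y) U. *)
have w_supp x y : cf w x y != 0 -> x = phi (x ^ y)%g.
  move=> /(gauge_conj FR wV F2E2) uJ.
  have xU : grp k x * U = U * grp k (x ^ y)%g.
    by apply: cfP => z t; rewrite cf_grpl cf_grpr !cfE -!cf_w1 uJ.
  apply: (@grp_inj k); rewrite -[LHS]mulr1 -[RHS]mulr1 -UV.1 !mulrA.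
  by rewrite xU phiU.
have FwE2 : F * dcomul w * E2 = dtens w * E2.
  by rewrite -(gaugeE F wV) -mulrA F2E2.
have [f [nzf f1 fJ]] := equivariant_rescaling char0 FC wV UV phiU w_e1 FwE2 w_supp.
pose fV x := (f x)^-1.
have fP : inverse_pair (dfun f) (dfun fV).
  by split; rewrite dfunM; apply: cfP => x y; rewrite cfE cf1 ?mulVf ?mulfV // mul1r.
(* Gauging by the function f multiplies b by the coboundary f(gh) / (f(g) f(h)). *)
pose b' x := fV x.1 * fV x.2 * b x * f (x.1 * x.2)%g.
have F3E : gauge (w * dfun f) (dfun fV * w') F = dfun b'.
  by rewrite -gauge_comp F2b /gauge -dtensE dtens_dfun dcomul_dfun !dfunM.
have wfP : inverse_pair (w * dfun f) (dfun fV * w').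
  split; rewrite mulrA.
    by rewrite -[w * _ * _]mulrA fP.1 mulr1 wV.1.
  by rewrite -[_ * w' * w]mulrA wV.2 mulr1 fP.2.
exists (w * dfun f), (dfun fV * w'), b'; split=> //.
- by under eq_bigr do rewrite cf_dfunr conj1g f1 mulr1 cf_w1.
- by rewrite -F3E; apply: gauge_invariant wfP fJ FC.
have bE1 x : b (1%g, x) = 1.
  by have := F2E1; rewrite -[RHS]mul1r => /E1P/(_ x 1 1)%g; rewrite cf1 eqxx.
have bE2 x : b (x, 1%g) = 1.
  by have := F2E2; rewrite -[RHS]mul1r => /E2P/(_ x 1 1)%g; rewrite cf1 eqxx.
move=> x; rewrite /b' /= bE1 bE2 mul1g mulg1 /fV f1 invr1 mul1r !mulr1.
by rewrite !mulVf.
Qed.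

End Diagonalization.

(** * From the double back to forms on DG^* *)

Section LinearExtension.

Variables (k : fieldType) (gT : finGroupType).
Local Notation H := (dualdouble k gT).
Local Notation elt := (dd_elt k).

Lemma dd_ext (V : lmodType k) (f g : H -> V) : linear f -> linear g ->
  (forall x y, f (elt x y) = g (elt x y)) -> f =1 g.
Proof.
move=> lin_f lin_g eq_fg a.
pose L (h : H -> V) lin_h : {linear H -> V} :=
  HB.pack h (GRing.isLinear.Build k H V _ h lin_h).
rewrite [a]dd_decomp -[f _]/(L f lin_f _) -[g _]/(L g lin_g _) !linear_sum.
by apply: eq_bigr => p _; rewrite !linearZ /= eq_fg.
Qed.

Lemma sweedler_linear (V : lmodType k) (f : H -> H -> V) : linear (sweedler f).
Proof.
move=> r u v; rewrite /sweedler scaler_sumr -big_split /=.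
apply: eq_bigr => q _; rewrite !ffunE dd_coordD dd_coordZ.
case: ifP => _; first by rewrite scalerDl scalerA.
by rewrite !scale0r scaler0 addr0.
Qed.

Lemma sweedler_linear_body (V : lmodType k) (f : H -> H -> H -> V) a :
  (forall a1 a2, linear (fun b => f b a1 a2)) ->
  linear (fun b => sweedler (f b) a).
Proof.
move=> lin_f r u v; rewrite /sweedler scaler_sumr -big_split /=.
apply: eq_bigr => q _; rewrite lin_f scalerDr; congr (_ + _).
by rewrite !scalerA mulrC.
Qed.

Lemma linear_mull (f : H -> k) (c : k) :
  linear (f : H -> k^o) -> linear (fun a => c * f a : k^o).
Proof. by move=> lin_f r u v; rewrite lin_f mulrDr; congr (_ + _); apply: mulrCA. Qed.

Lemma linear_mulr (f : H -> k) (c : k) :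
  linear (f : H -> k^o) -> linear (fun a => f a * c : k^o).
Proof. by move=> lin_f r u v; rewrite lin_f mulrDl; congr (_ + _); apply: esym (mulrA _ _ _). Qed.

Lemma biscalar_linearl (sigma : {biscalar H}) b : linear (fun a => sigma a b : k^o).
Proof. by move=> r u v; rewrite linearPl. Qed.

Lemma biscalar_linearr (sigma : {biscalar H}) a : linear (fun b => sigma a b : k^o).
Proof. by move=> r u v; rewrite linearPr. Qed.

(** Identifies D with the linear dual of DG^*; convolution corresponds to the product by
    [pairing_conv]. *)
Definition pairing (w : drinfeld k gT) (a : H) : k :=
  \sum_p dd_coord a p * cf w p.1 p.2.

Fact pairing_is_linear w : scalar (pairing w).
Proof.
move=> r a b; rewrite /pairing mulr_sumr -big_split.
by apply: eq_bigr => p _; rewrite dd_coordD dd_coordZ mulrDl mulrA.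
Qed.

HB.instance Definition _ w :=
  GRing.isLinear.Build k (dualdouble k gT) k *%R (pairing w) (pairing_is_linear w).

Lemma pairing_elt w x y : pairing w (elt x y) = cf w x y.
Proof.
rewrite /pairing (bigD1 (x, y)) //= big1 ?addr0 => [|p /negbTE np].
  by rewrite dd_coord_elt eqxx mul1r.
by rewrite dd_coord_elt np mul0r.
Qed.

Lemma pairing_conv w w' x y :
  conv1 (pairing w) (pairing w') (elt x y) = cf (w * w') x y.
Proof.
rewrite /conv1 sweedler_elt cfM; apply: eq_bigr => z _.
by rewrite /= !pairing_elt.
Qed.

Lemma pairing_inverse w w' :
  inverse_pair w w' -> conv_inverse1 (pairing w) (pairing w').
Proof.
case=> ww' w'w a.
have ext v v' : v * v' = 1 -> conv1 (pairing v) (pairing v') a = dd_counit a.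
  move=> vv'; apply: (dd_ext (V := k^o)) => [||x y]; first exact: sweedler_linear.
    by move=> r u t; rewrite linearP.
  by rewrite pairing_conv vv' cf1 dd_counit_elt.
by split; apply: ext.
Qed.

(** Converse to [twistV] and [twist_cocycle]: the conditions are multilinear, so the basis elements
    suffice. *)
Lemma twist_Z2 (sigma tau : {biscalar H}) :
  inverse_pair (twist sigma) (twist tau) -> dcocycle (twist sigma) ->
  (forall a, sigma 1 a = dd_counit a /\ sigma a 1 = dd_counit a) -> Z2 sigma.
Proof.
move=> [st ts] coc s1; split=> // [|a b c].
  exists tau => a b.
  have ext (s t : {biscalar H}) : twist s * twist t = 1 ->
      conv2 s t a b = dd_counit a * dd_counit b.
    move=> st1; rewrite -[LHS]/((fun a => conv2 s t a b : k^o) a).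
    apply: (dd_ext (V := k^o) (g := fun a => dd_counit a * dd_counit b)) => [||x1 y1].
    - exact: sweedler_linear.
    - by apply: linear_mulr => r u v; rewrite linearP.
    apply: (dd_ext (V := k^o) (f := conv2 s t _) (g := fun b => _ * dd_counit b)).
    - by apply: sweedler_linear_body => a1 a2; apply: sweedler_linear.
    - by apply: linear_mull => r u v; rewrite linearP.
    move=> x2 y2; rewrite -twistM st1 cf1 xpair_eqE !dd_counit_elt.
    by rewrite -natrM mulnb.
  by split; apply: ext.
pose lhs a b c : k^o := \sw_(a1, a2 <- a) \sw_(b1, b2 <- b)
  (sigma a1 b1 * sigma (a2 * b2) c : k^o).
pose rhs a b c : k^o := \sw_(b1, b2 <- b) \sw_(c1, c2 <- c)
  (sigma b1 c1 * sigma a (b2 * c2) : k^o).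
apply: (dd_ext (f := fun a => lhs a b c) (g := fun a => rhs a b c)) => [||x1 y1].
- exact: sweedler_linear.
- do 2![apply: sweedler_linear_body => ? ?]; apply: linear_mull.
  exact: biscalar_linearl.
apply: (dd_ext (f := fun b => lhs _ b c) (g := fun b => rhs _ b c)) => [||x2 y2].
- by apply: sweedler_linear_body => ? ?; apply: sweedler_linear.
- exact: sweedler_linear.
apply: (dd_ext (f := lhs _ _) (g := rhs _ _)) => [||x3 y3].
- do 2![apply: sweedler_linear_body => ? ?]; apply: linear_mull.
  exact: biscalar_linearr.
- by apply: sweedler_linear_body => ? ?; apply: sweedler_linear.
by rewrite /lhs /rhs cocycle_elt_l cocycle_elt_r coc.
Qed.

Lemma lazy_from_basis (sigma : {biscalar H}) :
  (forall x1 y1 x2 y2, let a := elt x1 y1 in let b := elt x2 y2 in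
    \sw_(a1, a2 <- a) \sw_(b1, b2 <- b) (sigma a1 b1 *: (a2 * b2)) =
    \sw_(a1, a2 <- a) \sw_(b1, b2 <- b) (sigma a2 b2 *: (a1 * b1))) ->
  lazy_cocycle sigma.
Proof.
move=> lazy a b.
pose lhs a b : H := \sw_(a1, a2 <- a) \sw_(b1, b2 <- b) (sigma a1 b1 *: (a2 * b2)).
pose rhs a b : H := \sw_(a1, a2 <- a) \sw_(b1, b2 <- b) (sigma a2 b2 *: (a1 * b1)).
apply: (dd_ext (f := fun a => lhs a b) (g := fun a => rhs a b)) => [||x1 y1].
- exact: sweedler_linear.
- exact: sweedler_linear.
apply: (dd_ext (f := lhs _) (g := rhs _)) => [||x2 y2].
- by apply: sweedler_linear_body => ? ?; apply: sweedler_linear.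
- by apply: sweedler_linear_body => ? ?; apply: sweedler_linear.
exact: lazy.
Qed.

Lemma twist_sigma_of (b : gT -> gT -> k) :
  twist (sigma_of b) = dfun (fun x => b x.1 x.2).
Proof.
apply: cfP => -[x1 x2] [y1 y2]; rewrite twistE /= sigma_of_elt cfE xpair_eqE.
by rewrite -mulrA -natrM mulnb.
Qed.

Lemma sum_elt1 (f : H -> k) s : linear (f : H -> k^o) ->
  (forall y, f (elt 1%g y) = (y == 1%g)%:R * s) -> f 1 = s.
Proof.
move=> lin_f fE; pose L : {linear H -> k^o} :=
  HB.pack (f : H -> k^o) (GRing.isLinear.Build k H k^o _ _ lin_f).
rewrite -[LHS]/(L 1) dd_oneE linear_sum (bigD1 1%g) //= big1 ?addr0 => [|y ny].
  by rewrite fE eqxx mul1r.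
by rewrite fE (negbTE ny) mul0r.
Qed.

Lemma sigma_of_Z2L (b : gT -> gT -> k) : Z2inv b -> Z2L (sigma_of b : {biscalar H}).
Proof.
move=> [nzb b1 bcoc bJ]; split.
  apply: (twist_Z2 (tau := sigma_of (fun g h => (b g h)^-1))).
  - rewrite !twist_sigma_of; split; rewrite dfunM.
      by apply: cfP => x y; rewrite cfE cf1 mulfV ?mul1r.
    by apply: cfP => x y; rewrite cfE cf1 mulVf ?mul1r.
  - rewrite twist_sigma_of; apply: cfP => -[[x1 x2] x3] [[y1 y2] y3].
    rewrite cf_cocyclel cf_cocycler.
    rewrite (sum_pair1 (a := 1%g) (b := 1%g)) => [|z t nzt]; last first.
      by rewrite cfE pair1 (negbTE nzt) mulr0 mul0r.
    rewrite (sum_pair1 (a := 1%g) (b := 1%g)) => [|z t nzt]; last first.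
      by rewrite cfE pair1 (negbTE nzt) mulr0 mul0r.
    rewrite !cfE /= !xpair_eqE !eqxx !invg1 !mul1g !conjg1 !mulr1.
    rewrite !mulrA ![_ * _%:R * b _ _]mulrAC bcoc -!mulrA -!natrM !mulnb.
    congr (_ * (_ * (nat_of_bool _)%:R)).
    by case: (y1 =P y2) => [->|]; case: (y2 =P y3) => [->|];
       rewrite ?eqxx ?andbF ?andbT //=; do ?case: eqP => //=; congruence.
  pose sb : {biscalar H} := sigma_of b.
  have sb_elt g x h y : sb (elt g x) (elt h y) = b g h * (x == 1%g)%:R * (y == 1%g)%:R.
    exact: sigma_of_elt.
  have lin_eps : linear (@dd_counit k gT : H -> k^o) by move=> r u v; rewrite linearP.
  move=> a; split.
    apply: (dd_ext (V := k^o) (f := sb 1) (g := @dd_counit k gT)) => //.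
      exact: biscalar_linearr.
    move=> x y; apply: (sum_elt1 (f := fun u => sb u _)); first exact: biscalar_linearl.
    by move=> z; rewrite sb_elt (b1 x).1 mul1r dd_counit_elt.
  apply: (dd_ext (V := k^o) (f := fun a => sb a 1) (g := @dd_counit k gT)) => //.
    exact: biscalar_linearl.
  move=> x y; apply: (sum_elt1 (f := sb _)); first exact: biscalar_linearr.
  by move=> z; rewrite sb_elt (b1 x).2 mul1r dd_counit_elt mulrC.
apply: lazy_from_basis => x1 y1 x2 y2 /=.
have cancel_eq (z y : gT) : (z^-1 * y == 1)%g = (z == y).
  by rewrite -(inj_eq (mulgI z)) mulKVg mulg1 eq_sym.
rewrite !sweedler_elt.
under eq_bigr do rewrite sweedler_elt.
under [RHS]eq_bigr do rewrite sweedler_elt.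
(* The counits leave one splitting on each side. On the right the arguments of b are conjugated by
   y1 and y2; the product of basis elements vanishes unless y1 = y2, and then b is invariant. *)
rewrite (sum_pair1 (a := 1%g) (b := 1%g)) => [|z t]; last first.
  rewrite sigma_of_elt xpair_eqE negb_and.
  by case/orP => /negbTE->; rewrite ?mulr0 ?mul0r scale0r.
rewrite (sum_pair1 (a := y1) (b := y2)) => [|z t]; last first.
  rewrite sigma_of_elt xpair_eqE negb_and !cancel_eq.
  by case/orP => /negbTE->; rewrite ?mulr0 ?mul0r scale0r.
rewrite !sigma_of_elt !mulVg !eqxx !mulr1 invg1 !mul1g !conjg1 !dd_mul_elt.
by case: eqP => [->|_]; rewrite ?scale0r ?scaler0 // -bJ.
Qed.

(** Solved for sigma, the gauge relation reads sigma = (w \otimes w) tau Delta(w') as twists: this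
    is the formula of cohomologous cocycles with eta the form of w. The sum of the coefficients of w
    at x = 1 is eta(1). *)
Lemma gauge_cohomologous (sigma tau : {biscalar H}) w w' :
  inverse_pair w w' -> \sum_y cf w 1%g y = 1 ->
  gauge w w' (twist sigma) = twist tau ->
  cohomologous sigma tau.
Proof.
move=> wV w1 gE.
have def_s : twist sigma = dtens w * (twist tau * dcomul w').
  by rewrite -gE mulrA gaugeE // -mulrA -dcomulM wV.1 dcomul1 mulr1.
exists (pairing w), (pairing w'); split.
- split; first by exists (pairing w'); apply: pairing_inverse.
  rewrite dd_oneE linear_sum -w1; apply: eq_bigr => y _.
  by rewrite /= pairing_elt.
- exact: pairing_inverse.
pose rhs a b : k^o := \sw_(a1, a2, a3 <- a) \sw_(b1, b2, b3 <- b)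
  (pairing w a1 * pairing w b1 * tau a2 b2 * pairing w' (a3 * b3) : k^o).
move=> a b; apply: (dd_ext (V := k^o) (f := fun a => sigma a b) (g := fun a => rhs a b)).
- exact: biscalar_linearl.
- exact: sweedler_linear.
move=> x1 y1; apply: (dd_ext (V := k^o) (f := sigma _) (g := rhs _)).
- exact: biscalar_linearr.
- by do 2![apply: sweedler_linear_body => ? ?]; apply: sweedler_linear.
move=> x2 y2; rewrite -twistE def_s /rhs sweedler_elt cfM sum_pair.
apply: eq_bigr => z1 _; rewrite sweedler_elt.
under [RHS]eq_bigr do rewrite sweedler_elt.
rewrite [RHS]exchange_big; apply: eq_bigr => z2 _ /=.
rewrite cfM sum_pair mulr_sumr; apply: eq_bigr => t1 _.
rewrite sweedler_elt mulr_sumr; apply: eq_bigr => t2 _.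
rewrite !pairV !pairM !pairJ cf_dtens twistE cf_comul dd_mul_elt linearZ.
by rewrite /= !pairing_elt !mulrA.
Qed.

End LinearExtension.

Theorem lemma5p11 (k : closedFieldType) (gT : finGroupType)
    (char0 : [pchar k] =i pred0) (sigma : {biscalar dualdouble k gT}) :
  Z2L sigma -> symmetric_cocycle sigma ->
  exists tau : {biscalar dualdouble k gT},
    [/\ Z2L tau,
        exists2 beta : gT -> gT -> k, Z2inv beta &
          forall a b : dualdouble k gT, tau a b = sigma_of beta a b
      & cohomologous sigma tau].
Proof.
move=> [sZ2 lazy] sym; have [[sigma' sV] s1 _] := sZ2.
have FV : inverse_pair (twist sigma) (twist sigma') by apply: twistV.
have Fcoc := twist_cocycle sZ2.
have FC : invariant_twist (twist sigma).
  by apply/invariant_twistP => c x1 x2 y1 y2; apply: twist_lazy.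
(* The unit of DG^* is the sum of the 1 \times e_s, so this is the normalization sigma(1, -) =
   epsilon. *)
have F1 t : \sum_s cf (twist sigma) (1, 1)%g (s, t) = (t == 1%g)%:R.
  under eq_bigr do rewrite twistE.
  by rewrite -linear_sumlz -dd_oneE (s1 _).1 dd_counit_elt.
have [w [w' [b [wV gE w1 bC b1]]]] :=
  twist_diagonalizable char0 FV Fcoc FC (twist_sym sym) F1.
pose beta g h := b (g, h).
have twist_beta : twist (sigma_of beta) = dfun b.
  by rewrite twist_sigma_of; apply: cfP => -[x1 x2] [y1 y2]; rewrite !cfE.
have beta_inv : Z2inv beta.
  split=> [g h|g|g h f|g h t].
  (* The gauged twist stays invertible, so the function b vanishes nowhere. *)
  - have [/(congr1 (fun X => cf X (g, h) 1%g)) + _] := gauge_inv wV FV.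
    rewrite gE cf_dfunl cf1 eqxx -/(beta g h) => bX.
    by apply: contraTneq isT => b0; move/eqP: bX; rewrite b0 mul0r eq_sym oner_eq0.
  - exact: b1.
  - have bcoc : dcocycle (dfun b) by rewrite -gE; apply: gauge_cocycle wV.1 Fcoc.
    have := congr1 (fun X => cf X (g, h, f) 1%g) bcoc.
    rewrite cf_cocyclel cf_cocycler.
    rewrite (sum_pair1 (a := 1%g) (b := 1%g)) => [|z t nzt]; last first.
      by rewrite cfE pair1 (negbTE nzt) mulr0 mul0r.
    rewrite (sum_pair1 (a := 1%g) (b := 1%g)) => [|z t nzt]; last first.
      by rewrite cfE pair1 (negbTE nzt) mulr0 mul0r.
    by rewrite !cfE !conjg1 mulVg !eqxx !mulr1 !mul1r.
  have /invariant_twistP/(_ t g h 1 1)%g := bC.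
  by rewrite !conj1g !cfE eqxx !mulr1 /beta => ->.
exists (sigma_of beta); split; first exact: sigma_of_Z2L.
  by exists beta.
by apply: gauge_cohomologous wV w1 _; rewrite gE twist_beta.
Qed.
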